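(* There is an absolute constant $C>0$ such that the following holds. Let $1\le p\le 2$ and let $f\in (B_{\infty,1}^1)_+(\mathbb{T}^2)$. Let $T_1,R_1,T_0,R_0$ be contractions (not necessarily commuting) on a Hilbert space such that $T_1-T_0\in\boldsymbol{S}_p$ and $R_1-R_0\in\boldsymbol{S}_p$. Then $f(T_1,R_1)-f(T_0,R_0)\in\boldsymbol{S}_p$ and $$\|f(T_1,R_1)-f(T_0,R_0)\|_{\boldsymbol{S}_p}\le C\,\|f\|_{B_{\infty,1}^1}\max\big\{\|T_1-T_0\|_{\boldsymbol{S}_p},\|R_1-R_0\|_{\boldsymbol{S}_p}\big\}.$$
   Context: Hilbert spaces are separable; a contraction is an operator of norm at most $1$; $\boldsymbol{S}_p$ is the Schatten--von Neumann class. Besov class. Fix an infinitely differentiable function $w\ge 0$ on $\mathbb{R}$ with $\operatorname{supp}w\subset[1/2,2]$ and $w(s)=1-w(s/2)$ for $s\in[1,2]$. For $j=(j_1,j_2)\in\mathbb{Z}^2$ let $|j|=(j_1^2+j_2^2)^{1/2}$ and $\zeta^j=\zeta_1^{j_1}\zeta_2^{j_2}$. Put $W_n(\zeta)=\sum_{j\in\mathbb{Z}^2}w(|j|/2^n)\zeta^j$ for $n\ge1$ and $W_0(\zeta)=\sum_{|j|\le1}\zeta^j+\sum_{1<|j|<2}w(|j|)\zeta^j$, $\zeta\in\mathbb{T}^2$. For a distribution $f$ on $\mathbb{T}^2$ put $f_n=f*W_n$, $n\ge0$, so that $f=\sum_{n\ge0}f_n$. Then $f\in B_{\infty,1}^1(\mathbb{T}^2)$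 if $\|f\|_{B_{\infty,1}^1}:=\sum_{n\ge0}2^n\|f_n\|_{L^\infty}<\infty$, and $(B_{\infty,1}^1)_+(\mathbb{T}^2)$ consists of those $f\in B_{\infty,1}^1(\mathbb{T}^2)$ whose Fourier coefficients satisfy $\widehat f(j_1,j_2)=0$ whenever $\min(j_1,j_2)<0$. Functions of noncommuting contractions. For $f\in (B_{\infty,1}^1)_+(\mathbb{T}^2)$ and contractions $T,R$, $$f(T,R)=\sum_{n\ge0}\sum_{j=0}^{2^{n+1}}T^j\Big(\sum_{k=0}^{2^{n+1}}\widehat{f_n}(j,k)R^k\Big),$$ where the series in $n$ converges absolutely in the operator norm. For an analytic polynomial $f$ this is $\sum_{j,k}\widehat f(j,k)T^jR^k$. *)

(* Defs.v *)
From HB Require Import structures.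
From mathcomp Require Import all_boot all_order all_algebra.
From mathcomp Require Import sesquilinear.
From mathcomp Require Import all_classical all_reals all_analysis.
From mathcomp Require Import ess_sup_inf complex.

Set Implicit Arguments.
Unset Strict Implicit.
Unset Printing Implicit Defensive.

Import Order.TTheory GRing.Theory Num.Theory.
Import numFieldNormedType.Exports.

Local Open Scope classical_set_scope.
Local Open Scope ring_scope.
Local Open Scope complex_scope.

(* The norm of a normed space over R[i] takes its values in R[i]; [rnorm] is
   the same number seen in R. *)
Definition rnorm (R : realType) (V : normedZmodType R[i]) (x : V) : R :=
  complex.Re `|x|.

Section Besov.
Variable R : realType.
Implicit Types (w : R -> R) (phi : R * R -> R[i]) (n : nat) (j k : int).

(* [derive1n m w] is a total function, hence the separate existence condition *)
Definition smooth w := forall (m : nat) (x : R), derivable (derive1n m w) x 1.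

Definition dyadic_window w :=
  [/\ smooth w,
      (forall s, 0 <= w s),
      closure [set s | w s != 0] `<=` `[2^-1, 2] &
      (forall s, 1 <= s <= 2 -> w s = 1 - w (s / 2))].

(* Functions on the torus are functions of the angles (x, y), 2pi-periodic in
   each of them. *)
Definition biperiodic phi := forall x y,
  phi (x + 2 * pi, y) = phi (x, y) /\ phi (x, y + 2 * pi) = phi (x, y).

Definition dir (b : bool) : R * R := if b then (1, 0) else (0, 1).

Definition partial (b : bool) phi : R * R -> R[i] := fun z =>
  'D_(dir b) (fun t => complex.Re (phi t)) z
  +i* 'D_(dir b) (fun t => complex.Im (phi t)) z.

Definition partials (s : seq bool) phi := foldr partial phi s.

Definition test_function phi :=
  biperiodic phi /\
  forall (s : seq bool), let g := partials s phi in
    [/\ continuous (fun t => complex.Re (g t)),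
        continuous (fun t => complex.Im (g t)) &
        forall b z, derivable (fun t => complex.Re (g t)) z (dir b) /\
                    derivable (fun t => complex.Im (g t)) z (dir b)].

(* Only the values on test functions are meaningful. *)
Record torus_distribution := TorusDistribution {
  dapp :> (R * R -> R[i]) -> R[i];
  dapp_linear : forall (a : R[i]) phi psi,
    test_function phi -> test_function psi ->
    dapp (fun z => a * phi z + psi z) = a * dapp phi + dapp psi;
  dapp_continuous : exists (N : nat) (K : R), forall phi (M : R),
    test_function phi ->
    (forall s z, (size s <= N)%N -> rnorm (partials s phi z) <= M) ->
    rnorm (dapp phi) <= K * M }.

Definition expi (t : R) : R[i] := cos t +i* sin t.

Definition character j k : R * R -> R[i] := fun z =>
  expi (j%:~R * z.1 + k%:~R * z.2).

Definition fourier (f : torus_distribution) j k : R[i] := f (character (- j) (- k)).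

Definition freq_norm j k : R := Num.sqrt (j%:~R ^+ 2 + k%:~R ^+ 2).

(* Fourier coefficients of the kernel W_n *)
Definition What w n j k : R :=
  let r := freq_norm j k in
  if n is 0%N then
    (if r <= 1 then 1 else if r < 2 then w r else 0)
  else w (r / 2 ^+ n).

(* Fourier coefficients of f_n = f * W_n *)
Definition LPcoef w (f : torus_distribution) n j k : R[i] :=
  fourier f j k * (What w n j k)%:C.

(* f_n as a function; its frequencies lie in the square [-2^(n+1), 2^(n+1)]^2 *)
Definition LPfun w (f : torus_distribution) n : R * R -> R[i] := fun z =>
  let freq (i : 'I_(2 ^ n.+2).+1) : int := i%:Z - (2 ^ n.+1)%:Z in
  \sum_i \sum_l LPcoef w f n (freq i) (freq l) * character (freq i) (freq l) z.

Definition torus : set (R * R) := `[0, 2 * pi] `*` `[0, 2 * pi].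

Lemma measurable_torus : measurable torus.
Proof. by apply: measurableX; exact: measurable_itv. Qed.

(* Lebesgue measure on the torus; its normalization is irrelevant for L^oo *)
Definition torus_measure :=
  mrestr (lebesgue_measure \x lebesgue_measure)%E measurable_torus.

Definition Linfty_norm (g : R * R -> R[i]) : \bar R :=
  ess_sup torus_measure (fun z => (rnorm (g z))%:E).

Definition besov_norm w (f : torus_distribution) : \bar R :=
  (\sum_(0 <= n <oo) (2 ^+ n)%:E * Linfty_norm (LPfun w f n))%E.

Definition besov_plus w (f : torus_distribution) :=
  (besov_norm w f < +oo)%E /\
  forall j k, Num.min j k < 0 -> fourier f j k = 0.

End Besov.

Record separable_hilbert (R : realType) := SeparableHilbert {
  hilbert_carrier :> completeNormedModType R[i];
  inner : {dot hilbert_carrier for Num.conj};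
  inner_norm : forall x, inner x x = `|x| ^+ 2;
  hilbert_separable :
    exists2 D : set hilbert_carrier, countable D & dense D }.

Section Operators.
Variables (R : realType) (H : separable_hilbert R).
Implicit Types (A T S : H -> H) (p : R).
Local Open Scope ereal_scope.

(* +oo for unbounded operators *)
Definition opnorm A : \bar R :=
  ereal_sup [set (rnorm (A x))%:E | x in [set x | (rnorm x <= 1)%R]].

Definition bounded_operator A := linear A /\ opnorm A < +oo.

Definition contraction_operator A := linear A /\ opnorm A <= 1.

Definition rank_le (n : nat) A :=
  exists v : 'I_n -> H, forall x, exists c : 'I_n -> R[i],
    A x = (\sum_(i < n) c i *: v i)%R.

Definition singular_value (n : nat) A : \bar R :=
  ereal_inf [set opnorm (A \- K)%R |
             K in [set K | bounded_operator K /\ rank_le n K]].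

Definition schatten_norm p A : \bar R :=
  (\sum_(0 <= n <oo) singular_value n A `^ p) `^ p^-1.

Definition schatten_class p A :=
  bounded_operator A /\ schatten_norm p A < +oo.

Definition fun_calc_block w (f : torus_distribution R) T S (n : nat) : H -> H :=
  fun x => (\sum_(j < (2 ^ n.+1).+1) iter j T
    (\sum_(k < (2 ^ n.+1).+1) LPcoef w f n j%:Z k%:Z *: iter k S x))%R.

(* f(T, S): the sum, in the operator norm, of the series of blocks *)
Definition fun_calc w (f : torus_distribution R) T S : H -> H :=
  get [set A | bounded_operator A /\
    (opnorm (fun x => A x - \sum_(n < N) fun_calc_block w f T S n x)%R
       @[N --> \oo] --> 0)].

End Operators.

(* Main.v *)
(* All operators are compressed to the span of finitely many vectors, so that
   everything happens for complex matrices, and it suffices to bound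
   g(T1, R) - g(T0, R) = sum_c T1^c A Y_c, with A = T1 - T0 and
   Y_c = sum_b T0^b g_(b+c+1)(R), for a polynomial g of degree N bounded by M on
   the torus; the second variable is the adjoint case.  By Parseval the N
   partial sums of zeta |-> g(zeta, R)x have an l^2 norm O(sqrt N M |x|), so that
   sum_c zeta^c Y_c is O(N M) on the circle, and the von Neumann inequality
   with coefficients acting on the other side gives the S_2 bound O(N M).  For
   A = w u^* the operator is sum_c (T1^c w)(Y_c^* u)^*, and the Y_c^* u come from
   a block Hankel operator with symbol g: this is the S_1 bound O(N M).  Real
   interpolation along a singular value decomposition of A covers 1 < p < 2 with
   a constant independent of p.  The singular values of the difference are
   recovered from its matrix coefficients by a greedy choice of orthonormal
   systems, and summing over the dyadic blocks produces the Besov norm. *)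
From HB Require Import structures.
Require Import Defs.
From mathcomp Require Import all_boot all_order all_algebra.
From mathcomp Require Import sesquilinear spectral.
From mathcomp Require Import all_classical all_reals all_analysis.
From mathcomp Require Import ess_sup_inf complex zify lra ring.
From mathcomp Require separable cyclic cyclotomic.

Set Implicit Arguments.
Unset Strict Implicit.
Unset Printing Implicit Defensive.

Import Order.TTheory GRing.Theory Num.Theory.
Import numFieldNormedType.Exports.
Local Open Scope ring_scope.

Local Open Scope complex_scope.
Local Open Scope sesquilinear_scope.

(** * Norms of complex matrices *)

(** Left multiplication by T1 commutes with right multiplication by the Y_c, and both act boundedly
    on Hilbert-Schmidt matrices. This is why a von Neumann inequality with operator coefficients is
    available in S_2. No operator-norm endpoint is used, so interpolation stops at p = 2. At the S_1
    end rank one suffices, because a singular value decomposition splits A into rank one pieces.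
    Schatten norms of matrices are never introduced. The trace norm of X is tested by the sums of
    |(F^* X E)_ii| over contractions E and F, and the same expressions, with E and F built from
    greedily chosen vectors, later give back singular values. Fourier analysis is exact summation
    over roots of unity, so no integral occurs. The partial sums cost no logarithm because they are
    evaluated at nodes with z^N = -1, where 1/(1 - z) is half a geometric sum. Each endpoint loses a
    factor N, the degree; for block n this is 2^(n+1), which the Besov weight 2^n absorbs. *)

Section RealNorm.
Variables (R : realType) (V : normedZmodType R[i]).
Implicit Types x y : V.

Lemma rnormE x : (rnorm x)%:C = `|x|.
Proof. by rewrite /rnorm RRe_real // normr_real. Qed.

Lemma rnorm_ge0 x : 0 <= rnorm x.
Proof. by rewrite -lecR rnormE normr_ge0. Qed.

Lemma rnormD x y : rnorm (x + y) <= rnorm x + rnorm y.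
Proof. by rewrite -lecR rmorphD /= !rnormE ler_normD. Qed.

Lemma rnormN x : rnorm (- x) = rnorm x.
Proof. by apply: complexI; rewrite !rnormE normrN. Qed.

Lemma rnorm0 : rnorm (0 : V) = 0.
Proof. by apply: complexI; rewrite rnormE normr0. Qed.

Lemma rnorm_eq0 x : (rnorm x == 0) = (x == 0).
Proof.
rewrite -(normr_eq0 x) -rnormE -[0 in RHS](rmorph0 (real_complex R)).
by rewrite (inj_eq (@complexI R)).
Qed.

Lemma rnorm_sum (I : Type) (r : seq I) (P : pred I) (F : I -> V) :
  rnorm (\sum_(i <- r | P i) F i) <= \sum_(i <- r | P i) rnorm (F i).
Proof.
elim/big_rec2: _ => [|i a b _ le_ab]; first by rewrite rnorm0.
by rewrite (le_trans (rnormD _ _)) // lerD2l.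
Qed.

Lemma rnormB x y : rnorm (x - y) <= rnorm x + rnorm y.
Proof. by rewrite (le_trans (rnormD _ _)) // rnormN. Qed.

End RealNorm.

Section ComplexNorm.
Variable R : realType.
Implicit Types z t : R[i].

Lemma rnormM z t : rnorm (z * t) = rnorm z * rnorm t.
Proof. by apply: complexI; rewrite rmorphM /= !rnormE normrM. Qed.

Lemma rnormX z n : rnorm (z ^+ n) = rnorm z ^+ n.
Proof. by apply: complexI; rewrite rmorphXn /= !rnormE normrX. Qed.

Lemma rnorm1 : rnorm (1 : R[i]) = 1.
Proof. by apply: complexI; rewrite rnormE normr1. Qed.

Lemma rnorm_conj z : rnorm (Num.conj z) = rnorm z.
Proof. by apply: complexI; rewrite !rnormE norm_conjC. Qed.

Lemma sqr_rnorm z : (rnorm z ^+ 2)%:C = z * Num.conj z.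
Proof. by rewrite rmorphXn /= rnormE normCK. Qed.

Lemma rnorm_real (a : R) : 0 <= a -> rnorm a%:C = a.
Proof. by move=> a0; apply: complexI; rewrite rnormE ger0_norm // lecR. Qed.

End ComplexNorm.

(** Lagrange's identity: the double sum of the squares (x_i y_j - x_j y_i)^2 is twice the difference
    of the two sides. *)
Lemma sum_cauchy_schwarz (R : realDomainType) (I : finType) (P : pred I)
    (x y : I -> R) :
  (\sum_(i | P i) x i * y i) ^+ 2 <=
  (\sum_(i | P i) x i ^+ 2) * (\sum_(i | P i) y i ^+ 2).
Proof.
have : 0 <= \sum_(i | P i) \sum_(j | P j) (x i * y j - x j * y i) ^+ 2.
  by apply: sumr_ge0 => i _; apply: sumr_ge0 => j _; exact: sqr_ge0.
set X := \sum_(i | P i) x i ^+ 2; set Y := \sum_(i | P i) y i ^+ 2.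
set Z := \sum_(i | P i) x i * y i.
have -> : \sum_(i | P i) \sum_(j | P j) (x i * y j - x j * y i) ^+ 2 =
   \sum_(i | P i) (x i ^+ 2 * Y + y i ^+ 2 * X - 2 * (x i * y i * Z)).
  apply: eq_bigr => i _; rewrite !mulr_sumr -sumrN -!big_split /=.
  by apply: eq_bigr => j _; ring.
rewrite sumrB big_split /= -!mulr_suml -mulr_sumr -mulr_suml -/X -/Y -/Z.
by move=> h; nra.
Qed.

Section Frobenius.
Variable R : realType.
Local Notation C := R[i].

Definition fro2 m n (A : 'M[C]_(m, n)) : R := \sum_i \sum_j rnorm (A i j) ^+ 2.

Definition fro m n (A : 'M[C]_(m, n)) : R := Num.sqrt (fro2 A).

Lemma fro2_ge0 m n (A : 'M[C]_(m, n)) : 0 <= fro2 A.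
Proof. by apply: sumr_ge0 => i _; apply: sumr_ge0 => j _; exact: sqr_ge0. Qed.

Lemma fro_ge0 m n (A : 'M[C]_(m, n)) : 0 <= fro A.
Proof. exact: sqrtr_ge0. Qed.

Lemma sqr_fro m n (A : 'M[C]_(m, n)) : fro A ^+ 2 = fro2 A.
Proof. by rewrite sqr_sqrtr ?fro2_ge0. Qed.

Lemma fro2_tr m n (A : 'M[C]_(m, n)) : (fro2 A)%:C = \tr (A *m A^t*).
Proof.
rewrite /mxtrace rmorph_sum; apply: eq_bigr => i _.
rewrite rmorph_sum /= !mxE; apply: eq_bigr => j _.
by rewrite sqr_rnorm !mxE.
Qed.

Lemma fro2_adj m n (A : 'M[C]_(m, n)) : fro2 (A^t*) = fro2 A.
Proof.
rewrite /fro2 exchange_big; apply: eq_bigr => i _; apply: eq_bigr => j _.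
by rewrite !mxE rnorm_conj.
Qed.

Lemma fro2_0 m n : fro2 (0 : 'M[C]_(m, n)) = 0.
Proof. by rewrite /fro2 !big1 // => i _; rewrite big1 // => j _; rewrite mxE rnorm0 expr0n. Qed.

Lemma fro2Z m n a (A : 'M[C]_(m, n)) : fro2 (a *: A) = rnorm a ^+ 2 * fro2 A.
Proof.
rewrite /fro2 mulr_sumr; apply: eq_bigr => i _; rewrite mulr_sumr.
by apply: eq_bigr => j _; rewrite !mxE rnormM exprMn.
Qed.

Lemma fro2_cols m n (A : 'M[C]_(m, n)) : fro2 A = \sum_j fro2 (col j A).
Proof.
rewrite /fro2 exchange_big; apply: eq_bigr => j _; apply: eq_bigr => i _.
by rewrite big_ord1 !mxE.
Qed.

Lemma fro2_cV n (x : 'cV[C]_n) : fro2 x = \sum_i rnorm (x i 0) ^+ 2.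
Proof. by apply: eq_bigr => i _; rewrite big_ord1. Qed.

Lemma fro2_diag n (A : 'M[C]_n) : \sum_i rnorm (A i i) ^+ 2 <= fro2 A.
Proof.
apply: ler_sum => i _; rewrite (bigD1 i) //= lerDl.
by apply: sumr_ge0 => j _; exact: sqr_ge0.
Qed.

Lemma mxtrace_cauchy_schwarz m n (A B : 'M[C]_(m, n)) :
  rnorm (\tr (A *m B^t*)) ^+ 2 <= fro2 A * fro2 B.
Proof.
have -> : \tr (A *m B^t*) =
    \sum_(p : 'I_m * 'I_n) A p.1 p.2 * Num.conj (B p.1 p.2).
  rewrite -(pair_bigA _ (fun i j => A i j * Num.conj (B i j))) /=.
  by apply: eq_bigr => i _; rewrite mxE; apply: eq_bigr => j _; rewrite !mxE.
rewrite /fro2 !pair_bigA /=.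
apply: (le_trans _ (sum_cauchy_schwarz _ _ _)).
rewrite lerXn2r ?nnegrE ?rnorm_ge0 //.
  by apply: sumr_ge0 => p _; rewrite mulr_ge0 ?rnorm_ge0.
apply: (le_trans (rnorm_sum _ _ _)); apply: ler_sum => p _.
by rewrite rnormM rnorm_conj.
Qed.

Lemma froD m n (A B : 'M[C]_(m, n)) : fro (A + B) <= fro A + fro B.
Proof.
rewrite -(@ler_pXn2r _ 2) ?nnegrE ?addr_ge0 ?fro_ge0 // sqrrD !sqr_fro.
rewrite /fro2 !pair_bigA /=; set S := (X in X <= _).
have -> : \sum_(p : 'I_m * 'I_n) rnorm (A p.1 p.2) ^+ 2 = fro A ^+ 2.
  by rewrite sqr_fro /fro2 pair_bigA.
have -> : \sum_(p : 'I_m * 'I_n) rnorm (B p.1 p.2) ^+ 2 = fro B ^+ 2.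
  by rewrite sqr_fro /fro2 pair_bigA.
have h : \sum_(p : 'I_m * 'I_n) rnorm (A p.1 p.2) * rnorm (B p.1 p.2) <=
    fro A * fro B.
  rewrite -(@ler_pXn2r _ 2) ?nnegrE ?mulr_ge0 ?fro_ge0 //; last first.
    by apply: sumr_ge0 => p _; rewrite mulr_ge0 ?rnorm_ge0.
  apply: (le_trans (sum_cauchy_schwarz _ _ _)).
  by rewrite exprMn !sqr_fro /fro2 !pair_bigA.
apply: (@le_trans _ _ (\sum_(p : 'I_m * 'I_n)
    (rnorm (A p.1 p.2) ^+ 2 + 2 * (rnorm (A p.1 p.2) * rnorm (B p.1 p.2)) +
    rnorm (B p.1 p.2) ^+ 2))).
  apply: ler_sum => p _; rewrite mxE.
  have := rnormD (A p.1 p.2) (B p.1 p.2).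
  have := rnorm_ge0 (A p.1 p.2 + B p.1 p.2); nra.
rewrite !big_split /= -mulr_sumr.
have -> : \sum_(p : 'I_m * 'I_n) rnorm (A p.1 p.2) ^+ 2 = fro A ^+ 2.
  by rewrite sqr_fro /fro2 pair_bigA.
have -> : \sum_(p : 'I_m * 'I_n) rnorm (B p.1 p.2) ^+ 2 = fro B ^+ 2.
  by rewrite sqr_fro /fro2 pair_bigA.
by rewrite lerD2r lerD2l mulr_natl lerMn2r h orbT.
Qed.

Lemma fro_sum m n (I : Type) (r : seq I) (P : pred I) (F : I -> 'M[C]_(m, n)) :
  fro (\sum_(i <- r | P i) F i) <= \sum_(i <- r | P i) fro (F i).
Proof.
elim/big_rec2: _ => [|i a b _ le_ab]; first by rewrite /fro fro2_0 sqrtr0.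
by rewrite (le_trans (froD _ _)) // lerD2l.
Qed.

Lemma fro_le m n (A : 'M[C]_(m, n)) (c : R) :
  0 <= c -> (fro A <= c) = (fro2 A <= c ^+ 2).
Proof.
by move=> c0; rewrite -sqr_fro ler_pXn2r ?nnegrE ?fro_ge0.
Qed.

(* [bnd K X]: the operator norm of [X] is at most [sqrt K] *)
Definition bnd m n (K : R) (X : 'M[C]_(m, n)) :=
  forall x : 'cV[C]_n, fro2 (X *m x) <= K * fro2 x.

Lemma bnd_mulmxl m n p K (X : 'M[C]_(m, n)) (A : 'M[C]_(n, p)) :
  bnd K X -> fro2 (X *m A) <= K * fro2 A.
Proof.
move=> hX; rewrite !fro2_cols mulr_sumr; apply: ler_sum => j _.
by rewrite !colE -mulmxA -!colE hX.
Qed.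

(** With a = X^* y, the square |a|^2 is the inner product of X a with y, so Cauchy-Schwarz gives
    |a|^4 <= K |a|^2 |y|^2, and |a|^2 cancels unless it is zero. *)
Lemma bnd_adj m n K (X : 'M[C]_(m, n)) : 0 <= K -> bnd K X -> bnd K (X^t*).
Proof.
move=> K0 hX y; set a := X^t* *m y.
have e : (fro2 a)%:C = \tr (X *m a *m y^t*).
  rewrite fro2_tr {2}/a trmx_mul map_mxM map_trmx trmxK -map_mx_comp.
  by rewrite (map_mx_id (@conjCK _)) mulmxA mxtrace_mulC mulmxA.
have h : fro2 a ^+ 2 <= K * fro2 a * fro2 y.
  rewrite -[fro2 a in X in X <= _](rnorm_real (fro2_ge0 a)) e.
  apply: (le_trans (mxtrace_cauchy_schwarz _ _)).
  by rewrite ler_wpM2r ?fro2_ge0 ?hX.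
have := fro2_ge0 a; rewrite le_eqVlt => /predU1P[<-|a0].
  by rewrite mulr_ge0 ?fro2_ge0.
by rewrite -(ler_pM2r a0) -expr2 (le_trans h) // mulrAC.
Qed.

Lemma bnd_mulmxr m n p K (X : 'M[C]_(n, p)) (A : 'M[C]_(m, n)) :
  0 <= K -> bnd K X -> fro2 (A *m X) <= K * fro2 A.
Proof.
move=> K0 /(bnd_adj K0) hX; rewrite -fro2_adj -(fro2_adj A).
by rewrite trmx_mul map_mxM bnd_mulmxl.
Qed.

Lemma bnd1X n (T : 'M[C]_n) c : bnd 1 T -> bnd 1 (T ^+ c).
Proof.
move=> hT; elim: c => [|c IHc] x; first by rewrite expr0 mul1mx mul1r.
rewrite exprS -mulmxA; apply: le_trans (hT _) _; rewrite mul1r.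
exact: IHc.
Qed.

End Frobenius.

(** * Parseval and convolution on roots of unity *)

Section Parseval.
Variable R : realType.
Local Notation C := R[i].

(** X^m - 1 splits over the closed field and is separable, so it has m distinct roots, and such a
    set of m-th roots of unity contains a primitive one. *)
Lemma prim_root_exists m : (0 < m)%N -> exists z : C, m.-primitive_root z.
Proof.
pose p : {poly C} := 'X^m - 1; have [r Dp] := closed_field_poly_normal p.
move=> m_gt0; rewrite (monicP _) ?monicXnsubC // scale1r in Dp.
have rm1 : all m.-unity_root r by apply/allP => z; rewrite -root_prod_XsubC -Dp.
have sz_r : (m < (size r).+1)%N.
  by rewrite -(size_prod_XsubC r id) -Dp size_XnsubC.
have [|z] := hasP (cyclic.has_prim_root m_gt0 rm1 _ sz_r); last by exists z.
by rewrite -separable.separable_prod_XsubC -Dp cyclotomic.separable_Xn_sub_1 // pnatr_eq0 -lt0n.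
Qed.

Lemma rnorm_root (z : C) m : (0 < m)%N -> rnorm (z ^+ m) = 1 -> rnorm z = 1.
Proof.
by move=> m0 /eqP; rewrite rnormX pexpr_eq1 ?rnorm_ge0 // => /eqP.
Qed.

Lemma rnorm_prim m (w : C) : m.-primitive_root w -> rnorm w = 1.
Proof.
by move=> hw; apply: (rnorm_root (prim_order_gt0 hw)); rewrite prim_expr_order ?rnorm1.
Qed.

Lemma unit_mul_conj (z : C) : rnorm z = 1 -> z * Num.conj z = 1.
Proof. by move=> z1; rewrite -sqr_rnorm z1 expr1n. Qed.

Lemma sum_prim_root m (w : C) (b c : nat) : m.-primitive_root w ->
  (b < m)%N -> (c < m)%N ->
  \sum_(s < m) (w ^+ s) ^+ b * Num.conj ((w ^+ s) ^+ c) = (m * (b == c))%:R.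
Proof.
move=> hw bm cm; have w1 := rnorm_prim hw.
pose q := w ^+ b * Num.conj (w ^+ c).
have -> : \sum_(s < m) (w ^+ s) ^+ b * Num.conj ((w ^+ s) ^+ c) = \sum_(s < m) q ^+ s.
  by apply: eq_bigr => s _; rewrite exprMn -rmorphXn -!exprM [(s * b)%N]mulnC [(s * c)%N]mulnC.
have cc : w ^+ c * Num.conj (w ^+ c) = 1.
  by apply: unit_mul_conj; rewrite rnormX w1 expr1n.
have [e|bc] := eqVneq b c.
  rewrite muln1 (eq_bigr (fun _ => 1)) ?sumr_const ?card_ord // => s _.
  by rewrite /q e cc expr1n.
rewrite muln0; apply/eqP.
have : (q - 1) * \sum_(s < m) q ^+ s = 0.
  rewrite -subrX1 /q exprMn -rmorphXn -!exprM ![(_ * m)%N]mulnC !exprM.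
  by rewrite (prim_expr_order hw) !expr1n rmorph1 mulr1 subrr.
move/eqP; rewrite mulf_eq0 subr_eq0 => /orP[/eqP q1|//].
have : w ^+ b == w ^+ c.
  have -> : w ^+ b = w ^+ c * q by rewrite /q mulrCA cc mulr1.
  by rewrite q1 mulr1.
by rewrite (eq_prim_root_expr hw) !modn_small // (negPf bc).
Qed.

(** Exponents below m are not aliased by m nodes, so the average over the nodes is exact. The
    rotation [eta] leaves orthogonality untouched and lets [tails_bound] avoid the node 1. *)
Lemma parseval_scalar m n (w eta : C) (y : nat -> C) :
  m.-primitive_root w -> rnorm eta = 1 -> (n <= m)%N ->
  \sum_(s < m) rnorm (\sum_(b < n) (eta * w ^+ s) ^+ b * y b) ^+ 2 =
  m%:R * \sum_(b < n) rnorm (y b) ^+ 2.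
Proof.
move=> hw eta1 nm; apply: complexI.
rewrite rmorphM !rmorph_sum /= rmorph_nat.
under eq_bigr => s _.
  rewrite sqr_rnorm rmorph_sum mulr_suml.
  under eq_bigr => b _ do rewrite mulr_sumr.
  over.
rewrite exchange_big mulr_sumr /=; apply: eq_bigr => b _.
rewrite exchange_big /= (bigD1 b) //= [X in _ + X]big1 ?addr0.
  under eq_bigr => s _.
    have -> : (eta * w ^+ s) ^+ b * y b * Num.conj ((eta * w ^+ s) ^+ b * y b) =
       y b * Num.conj (y b).
      rewrite rmorphM mulrACA (@unit_mul_conj ((eta * w ^+ s) ^+ b)) ?mul1r //.
      by rewrite rnormX rnormM rnormX eta1 (rnorm_prim hw) !expr1n mulr1 expr1n.
    over.
  by rewrite sumr_const card_ord sqr_rnorm mulr_natl.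
move=> c cb.
have -> : \sum_(s < m) (eta * w ^+ s) ^+ b * y b * Num.conj ((eta * w ^+ s) ^+ c * y c) =
   eta ^+ b * y b * Num.conj (eta ^+ c * y c) *
   \sum_(s < m) (w ^+ s) ^+ b * Num.conj ((w ^+ s) ^+ c).
  rewrite mulr_sumr; apply: eq_bigr => s _.
  by rewrite !exprMn !rmorphM /=; ring.
have bm : (b < m)%N by apply: leq_trans nm.
have cm : (c < m)%N by apply: leq_trans nm.
rewrite (sum_prim_root hw bm cm).
have /negPf -> : (b : nat) != c.
  by rewrite eq_sym; move: cb; apply: contra => /eqP e; apply/eqP/val_inj.
by rewrite muln0 mulr0.
Qed.

Lemma parseval m n p q (w eta : C) (y : nat -> 'M[C]_(p, q)) :
  m.-primitive_root w -> rnorm eta = 1 -> (n <= m)%N ->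
  \sum_(s < m) fro2 (\sum_(b < n) (eta * w ^+ s) ^+ b *: y b) =
  m%:R * \sum_(b < n) fro2 (y b).
Proof.
move=> hw eta1 nm; rewrite /fro2 exchange_big [in RHS]exchange_big mulr_sumr /=.
apply: eq_bigr => i _; rewrite exchange_big [in RHS]exchange_big mulr_sumr /=.
apply: eq_bigr => j _; rewrite -(parseval_scalar (fun b => y b i j) hw eta1 nm).
apply: eq_bigr => s _; congr (rnorm _ ^+ 2); rewrite summxE.
by apply: eq_bigr => b _; rewrite !mxE.
Qed.

Definition symbol p q (B : nat -> 'M[C]_(p, q)) N (z : C) := \sum_(c < N) z ^+ c *: B c.

(** At each root of unity of order J + N the transform of the convolution is the transform of h
    times the symbol of B. The product has degree below J + N, so nothing wraps around and Parseval
    applies on both sides. The coefficients multiply on the right, hence [bnd_mulmxr]. *)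
Lemma convolution_bound p q r (h : nat -> 'M[C]_(p, q)) (B : nat -> 'M[C]_(q, r)) J N K :
  0 <= K -> (forall z, rnorm z = 1 -> bnd K (symbol B N z)) ->
  \sum_(t < J + N) fro2 (\sum_(j < J) \sum_(c < N | (j + c == t)%N) h j *m B c) <=
  K * \sum_(j < J) fro2 (h j).
Proof.
move=> K0 hB.
have [m0|m_gt0] := posnP (J + N)%N.
  rewrite [X in X <= _]big1; last by move=> [t ht]; exfalso; rewrite m0 in ht.
  by rewrite mulr_ge0 // sumr_ge0 // => ? _; exact: fro2_ge0.
have [w hw] := prim_root_exists m_gt0.
have m_gt0R : 0 < (J + N)%:R :> R by rewrite ltr0n.
pose G t := \sum_(j < J) \sum_(c < N | (j + c == t)%N) h j *m B c.
rewrite -(ler_pM2l m_gt0R) -(parseval G hw (rnorm1 R) (leqnn _)) mulrCA.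
rewrite -(parseval h hw (rnorm1 R) (leq_addr _ _)) mulr_sumr.
apply: ler_sum => s _; set z := 1 * w ^+ s.
have z1 : rnorm z = 1 by rewrite /z mul1r rnormX (rnorm_prim hw) expr1n.
have -> : \sum_(b < J + N) z ^+ b *: G b = (\sum_(j < J) z ^+ j *: h j) *m symbol B N z.
  rewrite /G; under eq_bigr => b _.
    rewrite scaler_sumr; under eq_bigr => j _ do rewrite scaler_sumr big_mkcond.
    over.
  rewrite exchange_big mulmx_suml; apply: eq_bigr => j _ /=.
  rewrite exchange_big mulmx_sumr; apply: eq_bigr => c _ /=.
  have jc : (j + c < J + N)%N by apply: (@leq_trans (J + c)); rewrite ?ltn_add2r ?leq_add2l // ltnW.
  rewrite -big_mkcond (big_pred1 (Ordinal jc)) /=.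
    by rewrite -scalemxAl -scalemxAr scalerA exprD.
  by move=> b; rewrite eq_sym; apply/eqP/eqP => [e|->] //; exact: val_inj.
by apply: bnd_mulmxr => //; exact: hB.
Qed.
End Parseval.

(** * Spectral theorem and defect operators *)

Section Spectral.
Variable R : realType.
Local Notation C := R[i].

Lemma adj_mulmx m n p (A : 'M[C]_(m, n)) (B : 'M[C]_(n, p)) :
  (A *m B)^t* = B^t* *m A^t*.
Proof. by rewrite trmx_mul map_mxM. Qed.

Lemma adjE m n (A : 'M[C]_(m, n)) i j : (A^t*) i j = Num.conj (A j i).
Proof. by rewrite !mxE. Qed.

Lemma fro2_mul_tr m n p (X : 'M[C]_(m, n)) (A : 'M[C]_(n, p)) :
  (fro2 (X *m A))%:C = \tr (A^t* *m (X^t* *m X) *m A).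
Proof.
by rewrite fro2_tr adj_mulmx mxtrace_mulC !mulmxA.
Qed.

Lemma hermitian_diagonalization n (P : 'M[C]_n) : P^t* = P ->
  exists (U : 'M[C]_n) (s : 'rV[R]_n),
    [/\ U *m U^t* = 1%:M, U^t* *m U = 1%:M &
        P = U^t* *m diag_mx (map_mx (real_complex R) s) *m U].
Proof.
move=> PH.
have Ph : P \is hermsymmx by apply/is_hermitianmxP; rewrite expr0 scale1r PH.
have Un := spectral_unitarymx P.
exists (spectralmx P), (map_mx (@complex.Re R) (spectral_diag P)).
have UU : spectralmx P *m (spectralmx P)^t* = 1%:M by apply/unitarymxP.
split=> //.
  by rewrite -(invmx_unitary Un) mulVmx // spectral_unit.
have -> : map_mx (real_complex R) (map_mx (@complex.Re R) (spectral_diag P)) =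
    spectral_diag P.
  apply/rowP => j; rewrite !mxE /= RRe_real //.
  by have /mxOverP/(_ 0 j) := hermitian_spectral_diag_real Ph.
rewrite -(invmx_unitary Un).
by have /orthomx_spectralP := hermitian_normalmx Ph.
Qed.

(** 1 - T^*T is hermitian, and its eigenvalues are nonnegative because its quadratic form at x is
    |x|^2 - |T x|^2. Diagonalising it by U and taking roots of the eigenvalues gives D with D^*D = 1
    - T^*T; D need not be hermitian. *)
Lemma defect_operator n (T : 'M[C]_n) : bnd 1 T ->
  exists D : 'M[C]_n, forall p (A : 'M[C]_(n, p)),
    fro2 (D *m A) = fro2 A - fro2 (T *m A).
Proof.
move=> hT; pose P := 1%:M - T^t* *m T.
have PH : P^t* = P.
  by rewrite /P linearB /= map_mxB trmx1 map_mx1 adj_mulmx trmxCK.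
have [U [s [UU U'U eP]]] := hermitian_diagonalization PH.
have trP p (A : 'M[C]_(n, p)) : \tr (A^t* *m P *m A) = (fro2 A - fro2 (T *m A))%:C.
  rewrite rmorphB /= fro2_mul_tr fro2_tr /P mulmxBr mulmxBl linearB /= mulmx1.
  by rewrite [in RHS]mxtrace_mulC.
have s_ge0 i : 0 <= s 0 i.
  pose x := col i (U^t*).
  have : \tr (x^t* *m P *m x) = (s 0 i)%:C.
    have Ux : U *m x = delta_mx i 0 by rewrite /x colE mulmxA UU mul1mx.
    have -> : x^t* *m P *m x = (delta_mx i 0)^t* *m
        diag_mx (map_mx (real_complex R) s) *m delta_mx i 0.
      by rewrite -Ux adj_mulmx eP !mulmxA.
    rewrite -mulmxA mxtrace_mulC -mulmxA.
    have -> : (delta_mx i 0 : 'cV[C]_n) *m (delta_mx i 0)^t* = delta_mx i i.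
      by rewrite trmx_delta map_delta_mx mul_delta_mx.
    rewrite mul_diag_mx /mxtrace (bigD1 i) //= !mxE !eqxx mulr1.
    by rewrite big1 ?addr0 // => j ji; rewrite !mxE (negPf ji) mulr0.
  rewrite trP => /complexI <-; rewrite subr_ge0.
  by apply: le_trans (hT x) _; rewrite mul1r.
pose q := map_mx (real_complex R) (map_mx Num.sqrt s).
exists (diag_mx q *m U) => p A; apply: complexI; rewrite fro2_mul_tr -trP.
suff -> : (diag_mx q *m U)^t* *m (diag_mx q *m U) = P by [].
rewrite eP adj_mulmx -!mulmxA; congr (_ *m _); rewrite !mulmxA; congr (_ *m _).
rewrite tr_diag_mx map_diag_mx mulmx_diag; congr diag_mx.
apply/rowP => j; rewrite !mxE /= conj_Creal; last by rewrite complex_real.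
by rewrite -rmorphM /= -expr2 sqr_sqrtr.
Qed.

End Spectral.

(** * Von Neumann inequality *)

Section VonNeumann.
Variable R : realType.
Local Notation C := R[i].

Lemma ler_sum_ord_widen (f : nat -> R) m n : (m <= n)%N -> (forall i, 0 <= f i) ->
  \sum_(i < m) f i <= \sum_(i < n) f i.
Proof.
move=> mn f0; rewrite (big_ord_widen n f mn) [leRHS](bigID (fun i : 'I_n => (i < m)%N)) /=.
by rewrite lerDl sumr_ge0.
Qed.

(** A correlation is a convolution read backwards: after replacing h j by h (J - 1 - j), with J = L
    + N, the i-th sum is the convolution coefficient of index J - 1 - i. The remaining coefficients
    are dropped. *)
Lemma shifted_convolution_bound p q r (h : nat -> 'M[C]_(p, q))
    (B : nat -> 'M[C]_(q, r)) L N K :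
  0 <= K -> (forall z, rnorm z = 1 -> bnd K (symbol B N z)) ->
  \sum_(i < L) fro2 (\sum_(c < N) h (i + c)%N *m B c) <=
  K * \sum_(j < L + N) fro2 (h j).
Proof.
move=> K0 hB; set J := (L + N)%N.
rewrite [in leRHS](reindex_inj rev_ord_inj) /=.
apply: le_trans (convolution_bound (fun j => h (J - j.+1)%N) J K0 hB).
pose F t := fro2 (\sum_(j < J) \sum_(c < N | (j + c == t)%N) h (J - j.+1)%N *m B c).
rewrite -/(F _) (_ : \sum_(t < J + N) _ = \sum_(t < J + N) F t) //.
have F0 t : 0 <= F t by exact: fro2_ge0.
apply: le_trans (ler_sum_ord_widen (leq_addr N J) F0).
rewrite [leRHS](reindex_inj rev_ord_inj) /=.
apply: le_trans (ler_sum_ord_widen (f := fun i => F (J - i.+1)%N) (leq_addr N L) _); last by [].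
rewrite le_eqVlt; apply/orP; left; apply/eqP.
apply: eq_bigr => i _; rewrite /F; congr fro2.
under [RHS]eq_bigr => j _ do rewrite big_mkcond.
rewrite exchange_big; apply: eq_bigr => c _ /=; rewrite -big_mkcond /=.
have iL := ltn_ord i; have cN := ltn_ord c.
have hj : (J - (i + c).+1 < J)%N by rewrite /J; lia.
rewrite (big_pred1 (Ordinal hj)) /=; first by congr (h _ *m _); rewrite /J; lia.
move=> j; have jJ := ltn_ord j; rewrite /= -val_eqE /=.
by apply/eqP/eqP; rewrite /J in jJ *; lia.
Qed.

(** A block Hankel matrix is a corner of a convolution: reversing h to h (N - 1 - b) makes the c-th
    sum the coefficient of index N + c, since (N - 1 - b) + (c + b + 1) = N + c. The first N
    coefficients are dropped. *)
Lemma hankel_bound p q r (h : nat -> 'M[C]_(p, q)) (B : nat -> 'M[C]_(q, r)) N M K :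
  0 <= K -> (forall z, rnorm z = 1 -> bnd K (symbol B M z)) ->
  (forall j, (M <= j)%N -> B j = 0) ->
  \sum_(c < M) fro2 (\sum_(b < N) h b *m B (c + b).+1) <= K * \sum_(b < N) fro2 (h b).
Proof.
move=> K0 hB B0; rewrite [in leRHS](reindex_inj rev_ord_inj) /=.
apply: le_trans (convolution_bound (fun j => h (N - j.+1)%N) N K0 hB).
rewrite big_split_ord /=; apply: ler_wpDl.
  by apply: sumr_ge0 => i _; exact: fro2_ge0.
rewrite le_eqVlt; apply/orP; left; apply/eqP.
apply: eq_bigr => c _; congr fro2.
rewrite (reindex_inj rev_ord_inj) /=; apply: eq_bigr => b _.
have bN := ltn_ord b.
case: (ltnP (c + (N - b.+1)).+1 M) => hM.
  rewrite (big_pred1 (Ordinal hM)) //= => j; rewrite /= -val_eqE /=.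
  by apply/eqP/eqP; lia.
rewrite B0 // mulmx0 big1 // => j /eqP e; have jM := ltn_ord j.
by exfalso; lia.
Qed.

(* With [D^*D = 1 - T^*T] the sequence [D T^j A] has square sum at most that of
   [A], and multiplying by the polynomial amounts to a convolution of that
   sequence; averaging over [N] steps controls the remainder [T^N Z]. *)
Lemma two_sided_von_neumann d e f (T : 'M[C]_d) (A : 'M[C]_(d, e))
    (B : nat -> 'M[C]_(e, f)) N K :
  0 <= K -> bnd 1 T -> (forall z, rnorm z = 1 -> bnd K (symbol B N z)) ->
  fro2 (\sum_(c < N) T ^+ c *m A *m B c) <= 3 * K * fro2 A.
Proof.
move=> K0 hT hB; set Z := \sum_(c < N) _.
have [N0|N_gt0] := posnP N.
  by rewrite /Z N0 big_ord0 fro2_0 !mulr_ge0 ?fro2_ge0.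
have [D hD] := defect_operator hT.
have TZ i : T ^+ i *m Z = \sum_(c < N) T ^+ (i + c) *m A *m B c.
  rewrite mulmx_sumr; apply: eq_bigr => c _.
  by rewrite exprD !mulmxA.
have T1 i p (X : 'M[C]_(d, p)) : fro2 (T ^+ i *m X) <= fro2 X.
  by rewrite -[leRHS]mul1r; apply: bnd_mulmxl; exact: bnd1X.
have telescope p (X : 'M[C]_(d, p)) n :
    \sum_(j < n) fro2 (D *m (T ^+ j *m X)) = fro2 X - fro2 (T ^+ n *m X).
  elim: n => [|n IHn]; first by rewrite big_ord0 expr0 mul1mx subrr.
  by rewrite big_ord_recr /= IHn hD mulmxA addrA subrK exprS.
have h1 : fro2 Z - fro2 (T ^+ N *m Z) <= K * fro2 A.
  have := shifted_convolution_bound (fun j => D *m (T ^+ j *m A)) N K0 hB.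
  rewrite telescope.
  under eq_bigr => i _.
    have -> : \sum_(c < N) D *m (T ^+ (i + c) *m A) *m B c = D *m (T ^+ i *m Z).
      by rewrite TZ mulmx_sumr; apply: eq_bigr => c _; rewrite -!mulmxA.
    over.
  rewrite telescope => h; apply: le_trans h _.
  by rewrite ler_wpM2l // gerBl fro2_ge0.
(* For i < N one has T^N Z = T^(N-i) (T^i Z), so each of the N terms on the left is at least |T^N
   Z|^2, while the right side has 2N terms of size at most |A|^2. This costs a factor 2, and the 3
   of the statement is 1 + 2. *)
have h2 : N%:R * fro2 (T ^+ N *m Z) <= K * (N + N)%:R * fro2 A.
  have := shifted_convolution_bound (fun j => T ^+ j *m A) N K0 hB.
  move=> h; apply: le_trans (le_trans h _); last first.
    rewrite -mulrA ler_wpM2l // mulr_natl -[leRHS](_ : \sum_(i < N + N) fro2 A = _).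
      by apply: ler_sum => i _; exact: T1.
    by rewrite sumr_const card_ord.
  rewrite mulr_natl -[leLHS](_ : \sum_(i < N) fro2 (T ^+ N *m Z) = _).
    apply: ler_sum => i _; rewrite -TZ.
    have -> : T ^+ N = T ^+ (N - i) * T ^+ i by rewrite -exprD subnK // ltnW.
    by rewrite -mulmxA; exact: T1.
  by rewrite sumr_const card_ord.
have N_gt0R : 0 < N%:R :> R by rewrite ltr0n.
have h3 : fro2 (T ^+ N *m Z) <= 2 * K * fro2 A.
  rewrite -(ler_pM2l N_gt0R); apply: le_trans h2 _.
  by rewrite natrD le_eqVlt; apply/orP; left; apply/eqP; ring.
by lra.
Qed.

Lemma fro2B_le m n (A B : 'M[C]_(m, n)) : fro2 (A - B) <= 2 * fro2 A + 2 * fro2 B.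
Proof.
rewrite -!sqr_fro; have := froD A (- B).
have -> : fro (- B) = fro B by rewrite /fro -scaleN1r fro2Z rnormN rnorm1 expr1n mul1r.
move=> h; have : fro (A - B) ^+ 2 <= (fro A + fro B) ^+ 2.
  by rewrite lerXn2r ?nnegrE ?addr_ge0 ?fro_ge0.
have := sqr_ge0 (fro A - fro B); lra.
Qed.

(** With tau_b the tail after b and Y the polynomial with coefficients y_j, summation by parts gives
    (1 - x) sum_b x^b tau_b = Y(1) - Y(x), of square norm at most 4 S on the circle. Ordinary N-th
    roots of unity contain x = 1; on the rotated set x^N = -1 one has instead (1 - x) g = 2 for g =
    sum_(b<N) x^b, so division by 1 - x is multiplication by g / 2. Parseval for g itself, whose
    square sum over the nodes is N^2, then gives the bound without a logarithm. *)
Lemma tails_bound p q (y : nat -> 'M[C]_(p, q)) N S :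
  (forall z, rnorm z = 1 -> fro2 (symbol y N.+1 z) <= S) ->
  \sum_(b < N) fro2 (\sum_(j < N.+1 | (b < j)%N) y j) <= N%:R * S.
Proof.
move=> hy; have [->|N_gt0] := posnP N; first by rewrite big_ord0 mul0r.
have [w hw] := prim_root_exists R N_gt0.
pose eta : C := N.-root (-1).
have etaN : eta ^+ N = -1 by rewrite rootCK.
have eta1 : rnorm eta = 1.
  by apply: (rnorm_root N_gt0); rewrite etaN rnormN rnorm1.
pose tau b := \sum_(j < N.+1 | (b < j)%N) y j.
have N_gt0R : 0 < N%:R :> R by rewrite ltr0n.
rewrite -(ler_pM2l N_gt0R) -(parseval tau hw eta1 (leqnn _)).
have -> : N%:R * (N%:R * S) =
    S * \sum_(s < N) rnorm (\sum_(b < N) (eta * w ^+ s) ^+ b * 1) ^+ 2.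
  rewrite (parseval_scalar (fun _ => 1) hw eta1 (leqnn _)).
  under eq_bigr => b _ do rewrite rnorm1 expr1n.
  by rewrite sumr_const card_ord; ring.
rewrite mulr_sumr; apply: ler_sum => s _.
set x := eta * w ^+ s.
have x1 : rnorm x = 1 by rewrite rnormM rnormX eta1 (rnorm_prim hw) expr1n mulr1.
have xN : x ^+ N = -1.
  by rewrite exprMn etaN -exprM mulnC exprM (prim_expr_order hw) expr1n mulr1.
have -> : \sum_(b < N) x ^+ b * 1 = \sum_(b < N) x ^+ b.
  by apply: eq_bigr => b _; rewrite mulr1.
set g := \sum_(b < N) x ^+ b.
have gx : (1 - x) * g = 2.
  by rewrite -opprB mulNr -subrX1 xN opprB opprK.
have eq_tau : (1 - x) *: \sum_(b < N) x ^+ b *: tau b =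
    symbol y N.+1 1 - symbol y N.+1 x.
  rewrite scaler_sumr.
  under eq_bigr => b _ do rewrite /tau scaler_sumr scaler_sumr big_mkcond.
  rewrite exchange_big /symbol -sumrB; apply: eq_bigr => j _ /=.
  rewrite -big_mkcond /= expr1n -scalerBl.
  have -> : 1 - x ^+ j = \sum_(b < N | (b < j)%N) (1 - x) * x ^+ b.
    rewrite -mulr_sumr -[1 - x]opprB mulNr.
    have jN : (j <= N)%N by rewrite -ltnS.
    by rewrite -(big_ord_widen N (fun b => x ^+ b) jN) -subrX1 opprB.
  by rewrite scaler_suml; apply: eq_bigr => b _; rewrite scalerA.
have -> : \sum_(b < N) x ^+ b *: tau b =
    (2^-1 * g) *: (symbol y N.+1 1 - symbol y N.+1 x).
  rewrite -eq_tau scalerA -mulrA [g * _]mulrC gx mulVf ?scale1r //.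
rewrite fro2Z rnormM exprMn.
have -> : rnorm (2^-1 : C) = 2^-1.
  by apply: complexI; rewrite rnormE normfV normr_nat fmorphV rmorph_nat.
have := hy 1 (rnorm1 R); have := hy x x1.
have := fro2B_le (symbol y N.+1 1) (symbol y N.+1 x).
set F := fro2 _; move=> h1 h2 h3; have h4 : F <= 4 * S by lra.
have := ler_wpM2r (sqr_ge0 (rnorm g)) h4; lra.
Qed.

End VonNeumann.

(** * Divided differences *)

Section DividedDifference.
Variable R : realType.
Local Notation C := R[i].

Lemma sum_tail_reindex (V : nmodType) (f : nat -> V) N c : (c <= N)%N ->
  (forall j, (N < j)%N -> f j = 0) ->
  \sum_(j < N.+1 | (c < j)%N) f j = \sum_(b < N) f (c + b).+1.
Proof.
move=> cN f0.
have -> : \sum_(j < N.+1 | (c < j)%N) f j = \sum_(c.+1 <= j < N.+1) f j.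
  by rewrite (big_nat_widenl c.+1 0) // big_mkord.
rewrite -{1}[c.+1]add0n big_addn subSS.
rewrite -(big_mkord predT (fun b => f (c + b).+1)%N).
rewrite [RHS](@big_cat_nat _ _ _ (N - c)) //= ?leq_subr //.
rewrite [X in _ = _ + X]big1_seq ?addr0.
  by apply: eq_bigr => b _; rewrite addnS addnC.
move=> b /=; rewrite mem_index_iota => /andP[h _]; apply: f0; lia.
Qed.

Variables (d r N : nat) (B : nat -> 'M[C]_(d, r)).
Hypothesis B0 : forall j, (N < j)%N -> B j = 0.
Implicit Types T A : 'M[C]_d.

(** The sum of z^c [ddiff_coef T0 c] is the difference quotient of sum_j z^j B_j between z and T0,
    with the powers of T0 to the left of the coefficients. Indices beyond N are harmless because B
    vanishes there. In [ddiff] the matrix A is kept separate from T1 - T0, since the linear map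
    sending A to [ddiff T1 T0 A] is what gets interpolated. *)
Definition ddiff_coef T0 c : 'M[C]_(d, r) := \sum_(b < N) T0 ^+ b *m B (c + b).+1.
Definition ddiff T1 T0 A : 'M[C]_(d, r) :=
  \sum_(c < N) T1 ^+ c *m A *m ddiff_coef T0 c.

Lemma ddiff_coefE T0 c : (c <= N)%N ->
  ddiff_coef T0 c = \sum_(j < N.+1 | (c < j)%N) T0 ^+ (j - c.+1) *m B j.
Proof.
move=> cN; rewrite (sum_tail_reindex (f := fun j => T0 ^+ (j - c.+1) *m B j)) //.
  by apply: eq_bigr => b _; rewrite subSS addKn.
by move=> j Nj; rewrite B0 // mulmx0.
Qed.

(** Telescoping: T1^j - T0^j is the sum over c < j of T1^c (T1 - T0) T0^(j-1-c). *)
Lemma ddiff_sub T1 T0 :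
  \sum_(j < N.+1) T1 ^+ j *m B j - \sum_(j < N.+1) T0 ^+ j *m B j =
  ddiff T1 T0 (T1 - T0).
Proof.
rewrite -sumrB /ddiff.
under [RHS]eq_bigr => c _.
  rewrite ddiff_coefE 1?ltnW // mulmx_sumr big_mkcond.
  over.
rewrite exchange_big /=; apply: eq_bigr => j _; rewrite -big_mkcond /=.
rewrite -mulmxBl.
have jN : (j <= N)%N by rewrite -ltnS.
pose f c := T1 ^+ c *m (T1 - T0) *m (T0 ^+ (j - c.+1) *m B j).
rewrite -/(f _) (_ : \sum_(c < N | (c < j)%N) _ = \sum_(c < N | (c < j)%N) f c) //.
rewrite -(big_ord_widen N f jN) /f.
under [RHS]eq_bigr => c _ do rewrite mulmxA.
rewrite -mulmx_suml; congr (_ *m _).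
have -> : T1 ^+ j - T0 ^+ j =
    \sum_(c < j) (T1 ^+ c.+1 * T0 ^+ (j - c.+1) - T1 ^+ c * T0 ^+ (j - c)).
  rewrite -(big_mkord predT (fun c => T1 ^+ c.+1 * T0 ^+ (j - c.+1) - T1 ^+ c * T0 ^+ (j - c))).
  rewrite (telescope_sumr (fun c => T1 ^+ c * T0 ^+ (j - c))) //.
  by rewrite subnn subn0 !expr0 mulr1 mul1r.
apply: eq_bigr => c _.
have -> : (j - c = (j - c.+1).+1)%N by have := ltn_ord c; lia.
rewrite exprSr exprS -[X in _ = X]/(T1 ^+ c * (T1 - T0) * T0 ^+ (j - c.+1)).
by rewrite mulrBr mulrBl !mulrA.
Qed.

Variable K : R.
Hypotheses (K0 : 0 <= K) (hB : forall z, rnorm z = 1 -> bnd K (symbol B N.+1 z)).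

(** Applied to x, the symbol is sum_b T0^b tau_b, where z^(b+1) tau_b is a tail of sum_j z^j B_j x.
    Cauchy-Schwarz over the N terms costs one factor N, and [tails_bound] the other. *)
Lemma ddiff_symbol_bnd T0 z : bnd 1 T0 -> rnorm z = 1 ->
  bnd (N%:R ^+ 2 * K) (symbol (ddiff_coef T0) N z).
Proof.
move=> hT z1 x.
pose y j := z ^+ j *: (B j *m x).
pose tau b := \sum_(c < N) z ^+ c *: (B (c + b).+1 *m x).
have tauE b : (b <= N)%N -> fro2 (tau b) = fro2 (\sum_(j < N.+1 | (b < j)%N) y j).
  move=> bN; rewrite (sum_tail_reindex (f := y) bN); last first.
    by move=> j Nj; rewrite /y B0 // mul0mx scaler0.
  rewrite /y.
  have -> : \sum_(c < N) z ^+ (b + c).+1 *: (B (b + c).+1 *m x) = z ^+ b.+1 *: tau b.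
    rewrite /tau scaler_sumr; apply: eq_bigr => c _.
    by rewrite scalerA -exprD addSn [(b + c)%N]addnC.
  by rewrite fro2Z rnormX z1 !expr1n mul1r.
have tails : \sum_(b < N) fro2 (tau b) <= N%:R * (K * fro2 x).
  under eq_bigr => b _ do rewrite tauE 1?ltnW //.
  apply: tails_bound => z' z'1.
  have -> : symbol y N.+1 z' = symbol B N.+1 (z * z') *m x.
    rewrite /symbol mulmx_suml; apply: eq_bigr => c _.
    by rewrite /y scalerA -scalemxAl exprMn [z' ^+ c * _]mulrC.
  by apply: hB; rewrite rnormM z1 z'1 mulr1.
have -> : symbol (ddiff_coef T0) N z *m x = \sum_(b < N) T0 ^+ b *m tau b.
  rewrite /symbol /ddiff_coef mulmx_suml.
  under eq_bigr => c _ do rewrite scaler_sumr mulmx_suml.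
  rewrite exchange_big /=; apply: eq_bigr => b _.
  rewrite /tau mulmx_sumr; apply: eq_bigr => c _.
  by rewrite -scalemxAl -scalemxAr mulmxA.
have h1 : fro (\sum_(b < N) T0 ^+ b *m tau b) <= \sum_(b < N) 1 * fro (tau b).
  apply: le_trans (fro_sum _ _ _) _; apply: ler_sum => b _; rewrite mul1r.
  by rewrite ler_sqrt ?fro2_ge0 // -[leRHS]mul1r; apply: bnd_mulmxl; exact: bnd1X.
have h2 : fro2 (\sum_(b < N) T0 ^+ b *m tau b) <= (\sum_(b < N) 1 * fro (tau b)) ^+ 2.
  by rewrite -fro_le // (le_trans (fro_ge0 _) h1).
apply: (le_trans h2); apply: (le_trans (sum_cauchy_schwarz _ _ _)).
under [X in X * _]eq_bigr => b _ do rewrite expr1n.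
under [X in _ * X]eq_bigr => b _ do rewrite sqr_fro.
rewrite sumr_const card_ord expr2 -!mulrA ler_wpM2l //.
Qed.

Lemma ddiff_fro T1 T0 A : bnd 1 T1 -> bnd 1 T0 ->
  fro2 (ddiff T1 T0 A) <= 3 * (N%:R ^+ 2 * K) * fro2 A.
Proof.
move=> hT1 hT0; apply: two_sided_von_neumann => //.
  by rewrite mulr_ge0 ?sqr_ge0.
by move=> z z1; exact: ddiff_symbol_bnd.
Qed.

(** For A = w u^* the compressed operator is a sum over c of a column p_c times a row q_c, so
    Cauchy-Schwarz over the pairs (i, c) bounds the diagonal sum. The columns satisfy |p_c| <= |w|;
    the rows form a block Hankel operator applied to the sequence u^* T0^b, which gives N K |u|^2
    through [hankel_bound]. *)
Lemma ddiff_rank1 T1 T0 (w u : 'cV[C]_d) n (E : 'M[C]_(r, n)) (F : 'M[C]_(d, n)) :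
  bnd 1 T1 -> bnd 1 T0 -> bnd 1 E -> bnd 1 F ->
  (\sum_i rnorm ((F^t* *m ddiff T1 T0 (w *m u^t*) *m E) i i)) ^+ 2 <=
  N%:R ^+ 2 * K * (fro2 w * fro2 u).
Proof.
move=> hT1 hT0 hE hF.
pose p c := F^t* *m (T1 ^+ c *m w).
pose q c := u^t* *m ddiff_coef T0 c *m E.
have e : F^t* *m ddiff T1 T0 (w *m u^t*) *m E = \sum_(c < N) p c *m q c.
  rewrite /ddiff mulmx_sumr mulmx_suml; apply: eq_bigr => c _.
  by rewrite /p /q !mulmxA.
have h : \sum_i rnorm ((\sum_(c < N) p c *m q c) i i) <=
    \sum_(k : 'I_n * 'I_N) rnorm (p k.2 k.1 0) * rnorm (q k.2 0 k.1).
  rewrite -(pair_bigA _ (fun (i : 'I_n) (c : 'I_N) => rnorm (p c i 0) * rnorm (q c 0 i))) /=.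
  apply: ler_sum => i _; rewrite summxE; apply: le_trans (rnorm_sum _ _ _) _.
  by apply: ler_sum => c _; rewrite mxE big_ord1 rnormM.
rewrite e; apply: (@le_trans _ _ ((\sum_(k : 'I_n * 'I_N)
    rnorm (p k.2 k.1 0) * rnorm (q k.2 0 k.1)) ^+ 2)).
  rewrite lerXn2r ?nnegrE //; first by apply: sumr_ge0 => i _; exact: rnorm_ge0.
  by apply: sumr_ge0 => i _; rewrite mulr_ge0 ?rnorm_ge0.
apply: le_trans (sum_cauchy_schwarz _ _ _) _.
rewrite -(pair_bigA _ (fun (i : 'I_n) (c : 'I_N) => rnorm (p c i 0) ^+ 2)) exchange_big /=.
rewrite -(pair_bigA _ (fun (i : 'I_n) (c : 'I_N) => rnorm (q c 0 i) ^+ 2)) exchange_big /=.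
have -> : \sum_(c < N) \sum_i rnorm (p c i 0) ^+ 2 = \sum_(c < N) fro2 (p c).
  by apply: eq_bigr => c _; rewrite fro2_cV.
have -> : \sum_(c < N) \sum_i rnorm (q c 0 i) ^+ 2 = \sum_(c < N) fro2 (q c).
  by apply: eq_bigr => c _; rewrite /fro2 big_ord1.
have hp : \sum_(c < N) fro2 (p c) <= N%:R * fro2 w.
  rewrite mulr_natl -[leRHS](_ : \sum_(c < N) fro2 w = _); last by rewrite sumr_const card_ord.
  apply: ler_sum => c _; rewrite /p.
  apply: le_trans (bnd_adj ler01 hF _) _; rewrite mul1r.
  by apply: le_trans (bnd1X c hT1 _) _; rewrite mul1r.
have hq : \sum_(c < N) fro2 (q c) <= N%:R * K * fro2 u.
  apply: (@le_trans _ _ (\sum_(c < N) fro2 (u^t* *m ddiff_coef T0 c))).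
    apply: ler_sum => c _; rewrite /q.
    by apply: le_trans (bnd_mulmxr _ ler01 hE) _; rewrite mul1r.
  have := hankel_bound (fun b => u^t* *m T0 ^+ b) N K0 hB B0.
  move=> hh; apply: le_trans (le_trans _ hh) _.
    apply: le_trans (ler_sum_ord_widen (f := fun c => fro2 (u^t* *m ddiff_coef T0 c)) (leqnSn N) _) _.
      by move=> c; exact: fro2_ge0.
    apply: ler_sum => c _; rewrite le_eqVlt; apply/orP; left; apply/eqP; congr fro2.
    by rewrite /ddiff_coef mulmx_sumr; apply: eq_bigr => b _; rewrite mulmxA.
  rewrite [N%:R * K]mulrC -mulrA ler_wpM2l // mulr_natl.
  rewrite -[leRHS](_ : \sum_(c < N) fro2 u = _); last by rewrite sumr_const card_ord.
  apply: ler_sum => b _; rewrite -[leRHS]mul1r -(fro2_adj u).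
  by apply: bnd_mulmxr => //; exact: bnd1X.
apply: le_trans (ler_pM _ _ hp hq) _.
- by apply: sumr_ge0 => c _; exact: fro2_ge0.
- by apply: sumr_ge0 => c _; exact: fro2_ge0.
by rewrite le_eqVlt; apply/orP; left; apply/eqP; ring.
Qed.

End DividedDifference.

(** * Real interpolation between S_1 and S_2 *)

Section ConcaveComparison.
Variable R : realType.

(** Abel summation. The induction compares the weighted sum with its last weight times the
    unweighted sum, which is nonnegative by hypothesis. *)
Lemma abel_sum_ge0 (sigma a : nat -> R) n :
  (forall j, (j < n)%N -> 0 <= sigma j) ->
  (forall j, (j.+1 < n)%N -> sigma j.+1 <= sigma j) ->
  (forall k, (k <= n)%N -> 0 <= \sum_(j < k) a j) ->
  0 <= \sum_(j < n) sigma j * a j.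
Proof.
move=> s0 sd a0; case: n s0 sd a0 => [|n] s0 sd a0; first by rewrite big_ord0.
suff h : forall k, (k <= n)%N ->
    sigma k * \sum_(j < k.+1) a j <= \sum_(j < k.+1) sigma j * a j.
  by apply: le_trans (h n (leqnn _)); rewrite mulr_ge0 ?s0 ?a0.
elim=> [_|k IHk kn]; first by rewrite !big_ord1.
rewrite big_ord_recr [leRHS]big_ord_recr /= mulrDr lerD2r.
apply: le_trans (IHk (ltnW kn)); rewrite ler_wpM2r ?sd //.
by apply: a0; rewrite ltnW.
Qed.

(** Concavity of the power at the point a. With x = a e^u, the claim is the combination of e^v >= 1
    + v at v = (1 - th) u and at v = - th u, with weights th and 1 - th. *)
Lemma powR_le_tangent (a x th : R) : 0 <= th <= 1 -> 0 < a -> 0 < x ->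
  x `^ th <= a `^ th + th * (a `^ th / a) * (x - a).
Proof.
move=> /andP[th0 th1] a0 x0; set u := ln x - ln a.
have eth : x `^ th = a `^ th * expR (th * u).
  by rewrite /powR !gt_eqF // -expRD /u mulrBr addrC subrK.
have ex : x = a * expR u.
  rewrite /u expRD expRN !lnK ?posrE //.
  by rewrite mulrCA mulfV ?mulr1 // gt_eqF.
set A := a `^ th; have A0 : 0 < A by rewrite powR_gt0.
have -> : th * (A / a) * (x - a) = A * (th * (expR u - 1)).
  by rewrite {1}ex; field; rewrite gt_eqF.
rewrite eth -/A -[X in _ <= X + _](mulr1 A) -mulrDr ler_pM2l //.
set E := expR (th * u); have E0 : 0 < E by exact: expR_gt0.
have h1 : expR u = E * expR ((1 - th) * u) by rewrite -expRD -mulrDl addrC subrK mul1r.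
have h2 : 1 = E * expR (- (th * u)) by rewrite -expRD subrr expR0.
have k1 := expR_ge1Dx ((1 - th) * u); have k2 := expR_ge1Dx (- (th * u)).
have k1' : E * (1 + (1 - th) * u) <= expR u by rewrite h1 ler_pM2l.
have k2' : E * (1 - th * u) <= 1 by rewrite [leRHS]h2 ler_pM2l.
have q1 := ler_wpM2l th0 k1'.
have q2 := ler_wpM2l (_ : 0 <= 1 - th) k2'.
have th1' : 0 <= 1 - th by lra.
have := q2 th1'; lra.
Qed.

(* A concave nondecreasing function vanishing at [0] is, on a finite set, a
   nonnegative combination of the functions [x |-> min x t]. *)
Lemma concave_comparison (I : finType) (c x : I -> R) (th : R) :
  0 <= th <= 1 -> (forall i, 0 <= x i) ->
  (forall t, 0 < t -> 0 <= \sum_i c i * Num.min (x i) t) ->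
  0 <= \sum_(i | 0 < x i) c i * x i `^ th.
Proof.
move=> th01 x0 hc.
pose V := sort <=%R (undup (0 :: [seq x i | i <- enum I])).
have Vsort : sorted <=%R V by exact: sort_le_sorted.
have Vuniq : uniq V by rewrite sort_uniq undup_uniq.
have memV i : x i \in V by rewrite mem_sort mem_undup inE map_f ?orbT // mem_enum.
have mem0 : 0 \in V by rewrite mem_sort mem_undup inE eqxx.
pose u := nth 0 V.
have u_lt j k : (j < k)%N -> (k < size V)%N -> u j < u k.
  move=> jk kV; have jV := ltn_trans jk kV.
  rewrite lt_neqAle (nth_uniq 0 jV kV Vuniq) (ltn_eqF jk) /=.
  by apply: (sorted_leq_nth le_trans le_refl 0 Vsort); rewrite ?inE // ltnW.
have V_gt0 : (0 < size V)%N by move: mem0; case: V {Vsort Vuniq memV u u_lt}.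
have V_ge0 j : (j < size V)%N -> 0 <= u j.
  move=> jV; have : u j \in V by exact: mem_nth.
  rewrite mem_sort mem_undup inE => /predU1P[->//|/mapP[i _ ->]]; exact: x0.
have u0 : u 0%N = 0.
  apply/eqP; rewrite eq_le V_ge0 // andbT -(nth_index 0 mem0) -/(u _).
  have [<-|] := posnP (index 0 V); first by [].
  by move=> h; rewrite ltW // u_lt // index_mem.
pose k i := index (x i) V.
have kV i : (k i < size V)%N by rewrite index_mem.
have xE i : x i = u (k i) by rewrite /u nth_index.
have [r rE] : exists r, size V = r.+1 by case: (size V) V_gt0 => // r _; exists r.
pose G j := \sum_(i | (j < k i)%N) c i.
(* Layer cake: h (x i) telescopes along the sorted values up to x i, and exchanging the sums
   collects the weights c above level j into [G j]. *)
have decomp (h : R -> R) : h 0 = 0 ->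
    \sum_i c i * h (x i) = \sum_(j < r) (h (u j.+1) - h (u j)) * G j.
  move=> h0; rewrite /G.
  under [RHS]eq_bigr => j _ do rewrite mulr_sumr big_mkcond.
  rewrite exchange_big /=; apply: eq_bigr => i _; rewrite -big_mkcond /=.
  have kr : (k i <= r)%N by rewrite -ltnS -rE.
  rewrite -mulr_suml -(big_ord_widen r (fun j => h (u j.+1) - h (u j)) kr).
  rewrite -(big_mkord predT (fun j => h (u j.+1) - h (u j))).
  by rewrite (telescope_sumr (fun j => h (u j))) // u0 h0 subr0 -xE mulrC.
(* The power 0^0 equals 1, so for th = 0 the value at 0 must be set to 0 by hand for [decomp] to
   apply; the restriction to positive x i in the statement has the same effect. *)
pose h y : R := if 0 < y then y `^ th else 0.
have -> : \sum_(i | 0 < x i) c i * x i `^ th = \sum_i c i * h (x i).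
  rewrite big_mkcond; apply: eq_bigr => i _; rewrite /h.
  by case: ifP; rewrite // mulr0.
rewrite decomp; last by rewrite /h ltxx.
have tangent a y : 0 < a -> 0 <= y -> h y <= h a + th * (a `^ th / a) * (y - a).
  move=> a0; rewrite /h a0 le_eqVlt => /predU1P[<-|y0]; last first.
    by rewrite y0; exact: powR_le_tangent.
  rewrite ltxx /= sub0r mulrN -mulrA divfK ?gt_eqF //=.
  by rewrite subr_ge0 ler_piMl ?powR_ge0 //; case/andP: th01.
(* Slopes of h between consecutive values: nonnegative as h increases, nonincreasing as h is
   concave. These are the weights for Abel summation. *)
pose sg j := (h (u j.+1) - h (u j)) / (u j.+1 - u j).
have d_gt0 j : (j < r)%N -> 0 < u j.+1 - u j.
  by move=> jr; rewrite subr_gt0 u_lt // rE ltnS.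
rewrite (eq_bigr (fun j : 'I_r => sg j * ((u j.+1 - u j) * G j))); last first.
  by move=> j _; rewrite /sg mulrA divfK // gt_eqF ?d_gt0.
apply: (abel_sum_ge0 (a := fun j => (u j.+1 - u j) * G j)).
- move=> j jr; apply: divr_ge0; last by rewrite ltW ?d_gt0.
  rewrite subr_ge0 /h.
  have lt_u : u j < u j.+1 by rewrite -subr_gt0 d_gt0.
  have uj0 : 0 <= u j by rewrite V_ge0 // rE ltnS ltnW.
  rewrite (le_lt_trans uj0 lt_u); case: ifP => _; last exact: powR_ge0.
  have [th0 _] := andP th01.
  by apply: ge0_ler_powR; rewrite ?nnegrE ?th0 ?uj0 ?(le_trans uj0 (ltW lt_u)) ?ltW.
- move=> j jr; have jr' := ltnW jr.
  have uj0 : 0 <= u j by rewrite V_ge0 // rE ltnS ltnW.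
  have ua0 : 0 < u j.+1 by apply: le_lt_trans uj0 _; rewrite -subr_gt0 d_gt0.
  have ub0 : 0 <= u j.+2 by rewrite V_ge0 // rE ltnS.
  apply: (@le_trans _ _ (th * (u j.+1 `^ th / u j.+1))).
    rewrite /sg ler_pdivrMr ?d_gt0 // lerBlDl; exact: tangent.
  rewrite /sg ler_pdivlMr ?d_gt0 //.
  have := tangent _ _ ua0 uj0; lra.
(* The function y |-> min y (u n) has slope 1 below u n and 0 above, so the unweighted partial sum
   up to n is the hypothesis [hc] at the threshold u n. *)
- move=> n; rewrite leq_eqVlt => nr.
  case: n nr => [|n] nr; first by rewrite big_ord0.
  have nr' : (n < r)%N by case/orP: nr => [/eqP <-|/ltnW].
  have un0 : 0 < u n.+1.
    apply: le_lt_trans (V_ge0 n _) _; first by rewrite rE ltnS ltnW.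
    by rewrite -subr_gt0 d_gt0.
  have := hc (u n.+1) un0; rewrite (decomp (fun y => Num.min y (u n.+1))); last first.
    by apply/min_idPl; exact: ltW.
  rewrite (big_ord_widen r (fun j => (u j.+1 - u j) * G j) nr').
  rewrite [X in _ <= X -> _](bigID (fun j : 'I_r => (j < n.+1)%N)) /=.
  rewrite [X in _ + X]big1 ?addr0 => [|j]; last first.
    rewrite -leqNgt => nj; have jr := ltn_ord j.
    have le1 : u n.+1 <= u j.
      move: nj; rewrite leq_eqVlt => /predU1P[<-//|h1].
      by rewrite ltW // u_lt // rE ltnS ltnW.
    have le2 : u n.+1 <= u j.+1 by apply: le_trans le1 _; rewrite ltW // -subr_gt0 d_gt0.
    by rewrite !min_r // subrr mul0r.
  move=> h1; apply: le_trans h1 _; rewrite le_eqVlt; apply/orP; left; apply/eqP.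
  apply: eq_bigr => j jn; congr (_ * _).
  have le1 : u j.+1 <= u n.+1.
    move: jn; rewrite ltnS leq_eqVlt => /predU1P[->//|h2].
    by rewrite ltW // u_lt // rE ltnS.
  have le2 : u j <= u n.+1 by apply: le_trans le1; rewrite ltW // -subr_gt0 d_gt0.
  by rewrite !min_l.
Qed.

End ConcaveComparison.

Section Interpolation.
Variable R : realType.
Local Notation C := R[i].

(** Since b^p = b * b^(p-1) with 0 <= p - 1 <= 1, [concave_comparison] reduces the claim to
    comparing sums of b min(b, t) and s min(s, t) for every t. At level t the indices with s l > t
    are estimated by the l^1 hypothesis and the others by the l^2 one, which is why the latter is
    assumed for all subsets P. The factor 4 arises at fixed t, hence does not depend on p. *)
Lemma lp_interpolation (I J : finType) (s : J -> R) (beta : J -> I -> C) (p : R) :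
  1 <= p <= 2 -> (forall l, 0 <= s l) ->
  (forall l, \sum_i rnorm (beta l i) <= s l) ->
  (forall P : pred J, \sum_i rnorm (\sum_(l | P l) beta l i) ^+ 2 <=
    \sum_(l | P l) s l ^+ 2) ->
  \sum_i rnorm (\sum_l beta l i) `^ p <= 4 * \sum_l s l `^ p.
Proof.
move=> /andP[p1 p2] s0 h1 h2; set th := p - 1.
have th01 : 0 <= th <= 1 by rewrite /th; apply/andP; split; lra.
pose b i := rnorm (\sum_l beta l i).
have b0 i : 0 <= b i by exact: rnorm_ge0.
have p_neq0 : p != 0 by lra.
have powE (K : finType) (x : K -> R) : (forall k, 0 <= x k) ->
    \sum_k x k `^ p = \sum_(k | 0 < x k) x k * x k `^ th.
  move=> x0; rewrite [LHS](bigID (fun k => 0 < x k)) /= [X in _ + X]big1 ?addr0.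
    apply: eq_bigr => k xk; rewrite -{2}(powRr1 (x0 k)) -powRD ?(gt_eqF xk) ?implybT //.
    by rewrite /th addrC subrK.
  move=> k; rewrite -leNgt => xk; have -> : x k = 0 by apply/le_anti; rewrite xk x0.
  by rewrite powR0.
have key t : 0 < t ->
    \sum_i b i * Num.min (b i) t <= 4 * \sum_l s l * Num.min (s l) t.
  move=> t0.
  pose x i := rnorm (\sum_(l | t < s l) beta l i).
  pose y i := rnorm (\sum_(l | ~~ (t < s l)) beta l i).
  have bxy i : b i <= x i + y i.
    by rewrite /b (bigID (fun l => t < s l)) /=; exact: rnormD.
  have x0 i : 0 <= x i by exact: rnorm_ge0.
  have y0 i : 0 <= y i by exact: rnorm_ge0.
  (* Either b <= 2 x, and b min(b, t) <= 2 t x, or b <= 2 y, and b min(b, t) <= b^2 <= 4 y^2. *)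
  apply: (@le_trans _ _ (\sum_i (2 * t * x i + 4 * y i ^+ 2))).
    apply: ler_sum => i _; have := bxy i; have := b0 i; have := x0 i; have := y0 i.
    move: (b i) (x i) (y i) => c u v v0 u0 c0 cuv.
    have [uv|vu] := leP u v.
      have hm : Num.min c t <= c by rewrite ge_min lexx.
      have hm' := ler_wpM2l c0 hm.
      have c2 : c <= 2 * v by lra.
      have := ler_pM c0 c0 c2 c2; have := mulr_ge0 (ltW t0) u0; lra.
    have hm : Num.min c t <= t by rewrite ge_min lexx orbT.
    have hm' := ler_wpM2l c0 hm.
    have c2 : c <= 2 * u by lra.
    have := ler_wpM2r (ltW t0) c2; have := sqr_ge0 v; lra.
  rewrite big_split /= -!mulr_sumr.
  have X1 : \sum_i x i <= \sum_(l | t < s l) s l.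
    apply: (@le_trans _ _ (\sum_i \sum_(l | t < s l) rnorm (beta l i))).
      by apply: ler_sum => i _; exact: rnorm_sum.
    by rewrite exchange_big; apply: ler_sum => l _; exact: h1.
  have Y1 := h2 (fun l => ~~ (t < s l)).
  rewrite [in leRHS](bigID (fun l => t < s l)) /=.
  have -> : \sum_(l | t < s l) s l * Num.min (s l) t = t * \sum_(l | t < s l) s l.
    by rewrite mulr_sumr; apply: eq_bigr => l tl; rewrite (min_r (ltW tl)) mulrC.
  have -> : \sum_(l | ~~ (t < s l)) s l * Num.min (s l) t = \sum_(l | ~~ (t < s l)) s l ^+ 2.
    by apply: eq_bigr => l; rewrite -leNgt => tl; rewrite (min_l tl).
  have S0 : 0 <= \sum_(l | t < s l) s l by apply: sumr_ge0.
  have := ler_wpM2l (ltW t0) X1; have := mulr_ge0 (ltW t0) S0.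
  by rewrite -/(y _) in Y1 *; lra.
(* The two families become one on the disjoint union, with weights - b and 4 s, so that the
   comparison is the nonnegativity of a single sum. *)
pose z (k : I + J) := match k with inl i => b i | inr l => s l end.
pose c (k : I + J) := match k with inl i => - b i | inr l => 4 * s l end.
have z0 k : 0 <= z k by case: k => [i|l] /=; [exact: b0|exact: s0].
have hc t : 0 < t -> 0 <= \sum_k c k * Num.min (z k) t.
  move=> t0; rewrite big_sumType /=.
  under [X in X + _]eq_bigr => i _ do rewrite mulNr.
  under [X in _ + X]eq_bigr => l _ do rewrite -mulrA.
  by rewrite sumrN -mulr_sumr addrC subr_ge0 key.
have := concave_comparison th01 z0 hc.
rewrite big_sumType /= (powE _ b b0) (powE _ s s0).
under [X in X + _]eq_bigr => i _ do rewrite mulNr.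
under [X in _ + X]eq_bigr => l _ do rewrite -mulrA.
by rewrite sumrN -mulr_sumr addrC subr_ge0.
Qed.

(* Boundedness by [K] on both Schatten classes [S_2] and [S_1]; for the
   latter, on operators of rank one. *)
Definition schatten12_bounded d (Phi : 'M[C]_d -> 'M[C]_d) (K : R) :=
  [/\ 0 <= K, {morph Phi : A B / A + B},
      forall A, fro (Phi A) <= K * fro A &
      forall n (w u : 'cV[C]_d) (E F : 'M[C]_(d, n)), bnd 1 E -> bnd 1 F ->
        \sum_i rnorm ((F^t* *m Phi (w *m u^t*) *m E) i i) <= K * (fro w * fro u)].

Lemma fro2_diag_compress d n (A : 'M[C]_d) (E F : 'M[C]_(d, n)) :
  bnd 1 E -> bnd 1 F -> \sum_i rnorm ((F^t* *m A *m E) i i) ^+ 2 <= fro2 A.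
Proof.
move=> hE hF; apply: le_trans (fro2_diag _) _.
apply: le_trans (bnd_mulmxr _ ler01 hE) _; rewrite mul1r.
by apply: le_trans (bnd_mulmxl _ (bnd_adj ler01 hF)) _; rewrite mul1r.
Qed.

Lemma fro_adj m n (A : 'M[C]_(m, n)) : fro (A^t*) = fro A.
Proof. by rewrite /fro fro2_adj. Qed.

Lemma fro_0 m n : fro (0 : 'M[C]_(m, n)) = 0.
Proof. by rewrite /fro fro2_0 sqrtr0. Qed.

Lemma schatten12_bounded0 d : schatten12_bounded (fun _ : 'M[C]_d => 0) 0.
Proof.
split=> // [A B|A|n w u E F _ _]; rewrite ?addr0 ?fro_0 ?mul0r //.
by rewrite big1 // => i _; rewrite mulmx0 mul0mx mxE rnorm0.
Qed.

Lemma schatten12_boundedD d (Phi Psi : 'M[C]_d -> 'M[C]_d) K L :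
  schatten12_bounded Phi K -> schatten12_bounded Psi L ->
  schatten12_bounded (fun A => Phi A + Psi A) (K + L).
Proof.
move=> [K0 addP P2 P1] [L0 addQ Q2 Q1]; split.
- exact: addr_ge0.
- by move=> A B; rewrite addP addQ addrACA.
- move=> A; rewrite mulrDl; apply: le_trans (froD _ _) _; exact: lerD.
move=> n w u E F hE hF; rewrite mulrDl.
apply: le_trans (lerD (P1 _ w u E F hE hF) (Q1 _ w u E F hE hF)).
rewrite -big_split; apply: ler_sum => i _ /=.
by rewrite mulmxDr mulmxDl mxE rnormD.
Qed.

Lemma schatten12_bounded_sum d n (Phi : nat -> 'M[C]_d -> 'M[C]_d) (K : nat -> R) :
  (forall i, schatten12_bounded (Phi i) (K i)) ->
  schatten12_bounded (fun A => \sum_(i < n) Phi i A) (\sum_(i < n) K i).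
Proof.
move=> h; elim: n => [|n IHn].
  have -> : (fun A : 'M[C]_d => \sum_(i < 0) Phi i A) = fun=> 0.
    by apply/funext => A; rewrite big_ord0.
  by rewrite big_ord0; exact: schatten12_bounded0.
have -> : (fun A => \sum_(i < n.+1) Phi i A) = (fun A => \sum_(i < n) Phi i A + Phi n A).
  by apply/funext => A; rewrite big_ord_recr.
by rewrite big_ord_recr; exact: schatten12_boundedD.
Qed.

Lemma schatten12_bounded_adj d (Phi : 'M[C]_d -> 'M[C]_d) K :
  schatten12_bounded Phi K -> schatten12_bounded (fun A => (Phi (A^t*))^t*) K.
Proof.
move=> [K0 addP P2 P1]; split; first exact: K0.
- by move=> A B; rewrite linearD /= map_mxD addP linearD /= map_mxD.
- by move=> A; rewrite fro_adj -(fro_adj A).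
move=> n w u E F hE hF; rewrite adj_mulmx trmxCK [fro w * _]mulrC.
apply: le_trans (P1 _ u w F E hF hE); rewrite le_eqVlt; apply/orP; left; apply/eqP.
apply: eq_bigr => i _; rewrite -rnorm_conj -adjE !adj_mulmx !trmxCK.
by rewrite mulmxA.
Qed.

(* [c <= a k] whenever [A] is bounded below by [c] on a subspace of dimension
   [k.+1]: what the approximation numbers [a] of [A] satisfy. *)
Definition dominates_singular_values d (A : 'M[C]_d) (a : nat -> R) :=
  forall k (X : 'M[C]_(d, k.+1)) (c : R), 0 <= c -> X^t* *m X = 1%:M ->
    (forall z : 'cV[C]_k.+1, c ^+ 2 * fro2 z <= fro2 (A *m (X *m z))) -> c <= a k.

(** Diagonalising A^*A by U gives A = sum_l w_l u_l^*, with w_l the columns of A U^*, orthogonal of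
    norm s_l, and u_l orthonormal. The rank one bound is then the l^1 hypothesis of
    [lp_interpolation] for K s_l. Orthogonality gives every subsum the square norm sum s_l^2, which
    is the l^2 hypothesis. It remains to dominate the s_l by the numbers a_k. *)
Lemma schatten_interpolation d (Phi : 'M[C]_d -> 'M[C]_d) (K : R) (A : 'M[C]_d)
    (a : nat -> R) n (E F : 'M[C]_(d, n)) (p : R) :
  1 <= p <= 2 -> schatten12_bounded Phi K -> dominates_singular_values A a ->
  bnd 1 E -> bnd 1 F ->
  \sum_i rnorm ((F^t* *m Phi A *m E) i i) `^ p <=
  4 * (K `^ p * \sum_(k < d) a k `^ p).
Proof.
move=> hp [K0 addP P2 P1] hA hE hF.
have p0 : 0 <= p by case/andP: hp => *; lra.
have GH : (A^t* *m A)^t* = A^t* *m A by rewrite adj_mulmx trmxCK.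
have [U [s2 [UU U'U eG]]] := hermitian_diagonalization GH.
pose W := A *m U^t*.
have eA : A = W *m U by rewrite /W -mulmxA U'U mulmx1.
have WW : W^t* *m W = diag_mx (map_mx (real_complex R) s2).
  have -> : W^t* *m W = U *m (A^t* *m A) *m U^t*.
    by rewrite /W adj_mulmx trmxCK !mulmxA.
  by rewrite eG !mulmxA UU mul1mx -mulmxA UU mulmx1.
pose w l := col l W; pose u l := col l (U^t*); pose s l := fro (w l).
have s2E l : s2 0 l = s l ^+ 2.
  apply: complexI; rewrite sqr_fro fro2_tr mxtrace_mulC trace_mx11 mxE.
  have /matrixP/(_ l l) := WW; rewrite !mxE eqxx mulr1n => <-.
  by apply: eq_bigr => j _; rewrite !mxE.
have partE (P : pred 'I_d) :
    \sum_(l | P l) w l *m (u l)^t* = W *m diag_mx (\row_l (P l)%:R) *m U.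
  apply/matrixP => i j; rewrite summxE mul_mx_diag mxE big_mkcond.
  apply: eq_bigr => l _; rewrite !mxE big_ord1 !mxE conjCK.
  by case: (P l); rewrite ?mulr1 // mulr0 mul0r.
have partN (P : pred 'I_d) :
    fro2 (\sum_(l | P l) w l *m (u l)^t*) = \sum_(l | P l) s l ^+ 2.
  rewrite partE; apply: (@etrans _ _ (fro2 (W *m diag_mx (\row_l (P l)%:R)))).
    apply: complexI; rewrite !fro2_tr adj_mulmx mulmxA -(mulmxA _ U) UU.
    by rewrite mulmx1.
  rewrite fro2_cols big_mkcond [RHS]big_mkcond; apply: eq_bigr => l _ /=.
  have -> : col l (W *m diag_mx (\row_l (P l)%:R)) = (P l)%:R *: w l.
    by apply/colP => i; rewrite mxE mul_mx_diag !mxE mulrC.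
  rewrite fro2Z sqr_fro; case: (P l).
    by rewrite rnorm1 expr1n mul1r.
  by rewrite rnorm0 expr0n mul0r.
have Phi0 : Phi 0 = 0 by apply: (addrI (Phi 0)); rewrite -addP !addr0.
have PhiS (P : pred 'I_d) :
    Phi (\sum_(l | P l) w l *m (u l)^t*) = \sum_(l | P l) Phi (w l *m (u l)^t*).
  exact: (big_morph Phi addP Phi0).
pose beta l i := (F^t* *m Phi (w l *m (u l)^t*) *m E) i i.
have betaS (P : pred 'I_d) i : \sum_(l | P l) beta l i =
    (F^t* *m Phi (\sum_(l | P l) w l *m (u l)^t*) *m E) i i.
  by rewrite PhiS mulmx_sumr mulmx_suml summxE.
have u1 l : fro (u l) = 1.
  apply: (@etrans _ _ (Num.sqrt 1)); last exact: sqrtr1.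
  congr Num.sqrt; apply: complexI; rewrite fro2_tr mxtrace_mulC trace_mx11 mxE.
  have /matrixP/(_ l l) := UU; rewrite !mxE eqxx => e.
  rewrite rmorph1; apply: etrans e.
  by apply: eq_bigr => j _; rewrite !mxE conjCK mulrC.
have h1 l : \sum_i rnorm (beta l i) <= K * s l.
  by apply: le_trans (P1 _ _ _ _ _ hE hF) _; rewrite u1 mulr1.
have h2 (P : pred 'I_d) : \sum_i rnorm (\sum_(l | P l) beta l i) ^+ 2 <=
    \sum_(l | P l) (K * s l) ^+ 2.
  under eq_bigr => i _ do rewrite betaS.
  apply: le_trans (fro2_diag_compress _ hE hF) _.
  under [leRHS]eq_bigr => l _ do rewrite exprMn.
  rewrite -mulr_sumr -partN -!sqr_fro -exprMn lerXn2r ?nnegrE ?fro_ge0 //.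
  by rewrite mulr_ge0 ?fro_ge0.
have := lp_interpolation hp (fun l => mulr_ge0 K0 (fro_ge0 (w l))) h1 h2.
under [X in X <= _ -> _]eq_bigr => i _.
  rewrite betaS (_ : \sum_l w l *m (u l)^t* = A); last first.
    have diag1 : diag_mx (\row_l (xpredT l)%:R) = 1%:M :> 'M[C]_d.
      by apply/matrixP => k l; rewrite !mxE.
    by rewrite partE diag1 mulmx1 -eA.
  over.
move=> h; apply: le_trans h _; rewrite ler_pM2l ?ltr0n //.
under eq_bigr => l _ do rewrite powRM ?fro_ge0 //.
rewrite -mulr_sumr ler_wpM2l ?powR_ge0 //.
(* The right singular vectors indexed by S span a space of dimension k + 1 on which A is bounded
   below by c. *)
have minS (S : {set 'I_d}) k (c : R) : #|S| = k.+1 -> 0 <= c ->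
    (forall l, l \in S -> c <= s l) -> c <= a k.
  move=> cS c0 hc.
  pose f (j : 'I_k.+1) : 'I_d := enum_val (cast_ord (esym cS) j).
  have finj : injective f by move=> i j /enum_val_inj/cast_ord_inj.
  apply: (hA k (colsub f (U^t*))) => //.
    apply/matrixP => i j; rewrite !mxE.
    have /matrixP/(_ (f i) (f j)) := UU; rewrite !mxE (inj_eq finj) => <-.
    by apply: eq_bigr => l _; rewrite !mxE conjCK.
  move=> z; rewrite mulmxA.
  have -> : A *m colsub f (U^t*) = colsub f W.
    by apply/matrixP => i j; rewrite !mxE; apply: eq_bigr => l _; rewrite !mxE.
  have -> : fro2 (colsub f W *m z) = \sum_j s (f j) ^+ 2 * rnorm (z j 0) ^+ 2.
    apply: complexI; rewrite fro2_mul_tr.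
    have -> : (colsub f W)^t* *m colsub f W =
        diag_mx (\row_j (s (f j) ^+ 2)%:C).
      apply/matrixP => i j; rewrite !mxE.
      have /matrixP/(_ (f i) (f j)) := WW; rewrite !mxE (inj_eq finj) s2E => <-.
      by apply: eq_bigr => l _; rewrite !mxE.
    rewrite trace_mx11 mxE rmorph_sum; apply: eq_bigr => j _.
    by rewrite rmorphM /= sqr_rnorm mul_mx_diag !mxE mulrAC mulrC [_^* * _]mulrC.
  rewrite fro2_cV mulr_sumr; apply: ler_sum => j _.
  rewrite ler_wpM2r ?sqr_ge0 // lerXn2r ?nnegrE ?fro_ge0 //.
  by apply: hc; exact: enum_valP.
(* No sorting of the s_l is needed: removing a smallest element of a set of k + 1 indices, [minS]
   bounds it by a k. *)
have main k (S : {set 'I_d}) : #|S| = k ->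
    \sum_(l in S) s l `^ p <= \sum_(j < k) a j `^ p.
  elim: k S => [|k IHk] S cS.
    by rewrite (cards0_eq cS) big_set0 big_ord0.
  have /card_gt0P[l0 l0S] : (0 < #|S|)%N by rewrite cS.
  have [l1 l1S' hmin] := @arg_minP _ _ _ l0 (mem S) s l0S.
  have l1S : l1 \in S := l1S'.
  have cS1 : #|S :\ l1| = k by move: cS; rewrite (cardsD1 l1) l1S add1n => -[].
  rewrite (big_setD1 _ l1S) big_ord_recr /= addrC lerD ?IHk //.
  have le1 : s l1 <= a k by apply: (minS S) => //; exact: fro_ge0.
  by rewrite ge0_ler_powR ?nnegrE ?(le_trans (fro_ge0 (w l1)) le1) ?fro_ge0.
have := main d [set: 'I_d]; rewrite cardsT card_ord => /(_ erefl).
by rewrite (eq_bigl predT) // => l; rewrite inE.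
Qed.

End Interpolation.

(** * Polynomials in two noncommuting contractions *)

Section MatrixCalculus.
Variable R : realType.
Local Notation C := R[i].
Implicit Types g : nat -> nat -> C.

Definition poly_eval N g (z1 z2 : C) : C :=
  \sum_(j < N.+1) \sum_(k < N.+1) g j k * (z1 ^+ j * z2 ^+ k).

Definition torus_bound N g (M : R) := forall z1 z2, rnorm z1 = 1 -> rnorm z2 = 1 ->
  rnorm (poly_eval N g z1 z2) <= M.

Definition mx_calc d N g (T S : 'M[C]_d) : 'M[C]_d :=
  \sum_(j < N.+1) T ^+ j *m \sum_(k < N.+1) g j k *: S ^+ k.

Lemma torus_bound_ge0 N g M : torus_bound N g M -> 0 <= M.
Proof.
move=> /(_ 1 1 (rnorm1 R) (rnorm1 R)); apply: le_trans; exact: rnorm_ge0.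
Qed.

(** Cut off beyond N to meet the vanishing hypothesis of the divided differences; g itself may be
    nonzero there. *)
Definition coef_calc d N g (S : 'M[C]_d) (j : nat) : 'M[C]_d :=
  if (j <= N)%N then \sum_(k < N.+1) g j k *: S ^+ k else 0.

Lemma mx_calcE d N g (T S : 'M[C]_d) :
  mx_calc N g T S = \sum_(j < N.+1) T ^+ j *m coef_calc N g S j.
Proof. by apply: eq_bigr => j _; rewrite /coef_calc -ltnS ltn_ord. Qed.

(** For fixed z this is the scalar von Neumann inequality for S, with constant 3:
    [two_sided_von_neumann] is applied with the column x in the middle and 1 x 1 coefficients on the
    right. *)
Lemma coef_calc_symbol d N g M (S : 'M[C]_d) z : torus_bound N g M -> bnd 1 S ->
  rnorm z = 1 -> bnd (3 * M ^+ 2) (symbol (coef_calc N g S) N.+1 z).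
Proof.
move=> hg hS z1 x.
pose B k : 'M[C]_1 := (\sum_(j < N.+1) z ^+ j * g j k)%:M.
have -> : symbol (coef_calc N g S) N.+1 z *m x = \sum_(k < N.+1) S ^+ k *m x *m B k.
  rewrite /symbol mulmx_suml.
  under eq_bigr => j _.
    rewrite /coef_calc -ltnS ltn_ord scaler_sumr mulmx_suml.
    over.
  rewrite exchange_big /=; apply: eq_bigr => k _.
  rewrite /B mul_mx_scalar scaler_suml; apply: eq_bigr => j _.
  by rewrite scalerA -scalemxAl.
apply: two_sided_von_neumann; [exact: sqr_ge0|exact: hS|].
move=> zeta zeta1 y.
have -> : symbol B N.+1 zeta = (poly_eval N g z zeta)%:M.
  rewrite /symbol /B /poly_eval exchange_big rmorph_sum /=; apply: eq_bigr => k _.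
  rewrite scale_scalar_mx mulr_sumr; congr (_%:M); apply: eq_bigr => j _.
  by ring.
rewrite mul_scalar_mx fro2Z ler_wpM2r ?fro2_ge0 //.
by rewrite lerXn2r ?nnegrE ?rnorm_ge0 ?hg ?(torus_bound_ge0 hg).
Qed.

(** The symbol bound 3 K^2 gives the square constant 3 * N^2 * 3 K^2 = (3 N K)^2 in S_2, and the
    smaller 3 N^2 K^2 on rank one matrices. *)
Lemma ddiff_schatten12 d N (B : nat -> 'M[C]_d) (K : R) (T1 T0 : 'M[C]_d) :
  0 <= K -> (forall j, (N < j)%N -> B j = 0) ->
  (forall z, rnorm z = 1 -> bnd (3 * K ^+ 2) (symbol B N.+1 z)) ->
  bnd 1 T1 -> bnd 1 T0 -> schatten12_bounded (ddiff N B T1 T0) (3 * N%:R * K).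
Proof.
move=> K0 B0 hB hT1 hT0.
have K30 : 0 <= 3 * K ^+ 2 by rewrite mulr_ge0 ?sqr_ge0.
have L0 : 0 <= 3 * N%:R * K by rewrite !mulr_ge0.
split; first exact: L0.
- move=> A A'; rewrite /ddiff -big_split; apply: eq_bigr => c _ /=.
  by rewrite mulmxDr mulmxDl.
- move=> A; rewrite fro_le ?mulr_ge0 ?fro_ge0 //.
  apply: le_trans (ddiff_fro B0 K30 hB A hT1 hT0) _.
  rewrite exprMn sqr_fro ler_wpM2r ?fro2_ge0 //.
  by rewrite le_eqVlt; apply/orP; left; apply/eqP; ring.
move=> n w u E F hE hF.
rewrite -(@ler_pXn2r _ 2) ?nnegrE ?mulr_ge0 ?fro_ge0 //; last first.
  by apply: sumr_ge0 => i _; exact: rnorm_ge0.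
apply: le_trans (ddiff_rank1 B0 K30 hB w u hT1 hT0 hE hF) _.
rewrite exprMn [(fro w * _) ^+ 2]exprMn !sqr_fro.
rewrite ler_wpM2r ?mulr_ge0 ?fro2_ge0 //.
have : 0 <= N%:R ^+ 2 * K ^+ 2 by rewrite mulr_ge0 ?sqr_ge0.
by rewrite !exprMn; lra.
Qed.

Lemma mx_calc_diff_left d N g M (T1 T0 S : 'M[C]_d) :
  torus_bound N g M -> bnd 1 T1 -> bnd 1 T0 -> bnd 1 S ->
  exists2 Phi, schatten12_bounded Phi (3 * N%:R * M) &
    mx_calc N g T1 S - mx_calc N g T0 S = Phi (T1 - T0).
Proof.
move=> hg hT1 hT0 hS.
have B0 j : (N < j)%N -> coef_calc N g S j = 0 by move=> Nj; rewrite /coef_calc leqNgt Nj.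
exists (ddiff N (coef_calc N g S) T1 T0); last by rewrite !mx_calcE (ddiff_sub B0).
apply: ddiff_schatten12 => //; first exact: torus_bound_ge0 hg.
by move=> z z1; exact: coef_calc_symbol.
Qed.

Lemma adj_exp d (T : 'M[C]_d) n : (T ^+ n)^t* = (T^t*) ^+ n.
Proof.
elim: n => [|n IHn]; first by rewrite !expr0 trmx1 map_mx1.
by rewrite exprS adj_mulmx IHn exprSr.
Qed.

(** Adjoints reverse products, so T^j S^k becomes a power of S^* followed by one of T^*: the two
    variables trade places and the ordering of the calculus is kept. Thus estimates in the first
    variable yield those in the second. *)
Lemma mx_calc_adj d N g (T S : 'M[C]_d) :
  (mx_calc N g T S)^t* = mx_calc N (fun j k => Num.conj (g k j)) (S^t*) (T^t*).
Proof.
rewrite /mx_calc linear_sum /= map_mx_sum.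
under eq_bigr => j _.
  rewrite adj_mulmx linear_sum /= map_mx_sum mulmx_suml.
  over.
rewrite exchange_big; apply: eq_bigr => k _; rewrite mulmx_sumr.
apply: eq_bigr => j _ /=.
by rewrite linearZ /= map_mxZ !adj_exp -scalemxAl -scalemxAr.
Qed.

Lemma torus_bound_adj N g M :
  torus_bound N g M -> torus_bound N (fun j k => Num.conj (g k j)) M.
Proof.
move=> hg z1 z2 h1 h2.
rewrite -rnorm_conj.
have -> : Num.conj (poly_eval N (fun j k => Num.conj (g k j)) z1 z2) =
    poly_eval N g (Num.conj z2) (Num.conj z1).
  rewrite /poly_eval exchange_big rmorph_sum; apply: eq_bigr => k _ /=.
  rewrite rmorph_sum; apply: eq_bigr => j _ /=.
  by rewrite !rmorphM /= !rmorphXn /= conjCK [_ ^+ k * _]mulrC.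
by apply: hg; rewrite rnorm_conj.
Qed.

Lemma mx_calc_diff_right d N g M (T S1 S0 : 'M[C]_d) :
  torus_bound N g M -> bnd 1 T -> bnd 1 S1 -> bnd 1 S0 ->
  exists2 Phi, schatten12_bounded Phi (3 * N%:R * M) &
    mx_calc N g T S1 - mx_calc N g T S0 = Phi (S1 - S0).
Proof.
move=> hg hT hS1 hS0.
have [Phi hPhi eq_Phi] := mx_calc_diff_left (torus_bound_adj hg)
  (bnd_adj ler01 hS1) (bnd_adj ler01 hS0) (bnd_adj ler01 hT).
exists (fun A => (Phi (A^t*))^t*); first exact: schatten12_bounded_adj.
rewrite linearB /= map_mxB -eq_Phi -!mx_calc_adj -map_mxB -linearB /=.
by rewrite trmxCK.
Qed.

(** Cauchy-Schwarz over the N + 1 powers of T and Parseval for the coefficients give (N + 1) * 3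
    M^2, at most (3 N M)^2 once N >= 1. This cruder form is the one summed by the Besov norm, and it
    makes the series of blocks converge. *)
Lemma mx_calc_bnd d N g M (T S : 'M[C]_d) : (0 < N)%N ->
  torus_bound N g M -> bnd 1 T -> bnd 1 S ->
  bnd ((3 * N%:R * M) ^+ 2) (mx_calc N g T S).
Proof.
move=> N_gt0 hg hT hS x.
pose y j := coef_calc N g S j *m x.
have -> : mx_calc N g T S *m x = \sum_(j < N.+1) T ^+ j *m y j.
  by rewrite mx_calcE mulmx_suml; apply: eq_bigr => j _; rewrite /y mulmxA.
have h1 : \sum_(j < N.+1) fro2 (y j) <= 3 * M ^+ 2 * fro2 x.
  have [w hw] := prim_root_exists R (ltn0Sn N).
  have Np : 0 < N.+1%:R :> R by rewrite ltr0n.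
  rewrite -(ler_pM2l Np) -(parseval y hw (rnorm1 R) (leqnn _)).
  rewrite [leRHS]mulr_natl -[leRHS](_ : \sum_(s < N.+1) 3 * M ^+ 2 * fro2 x = _).
    apply: ler_sum => s _; set z := 1 * w ^+ s.
    have z1 : rnorm z = 1 by rewrite /z mul1r rnormX (rnorm_prim hw) expr1n.
    have -> : \sum_(b < N.+1) z ^+ b *: y b = symbol (coef_calc N g S) N.+1 z *m x.
      by rewrite /symbol mulmx_suml; apply: eq_bigr => b _; rewrite -scalemxAl.
    exact: coef_calc_symbol hg hS z1 x.
  by rewrite sumr_const card_ord.
have h2 : fro (\sum_(j < N.+1) T ^+ j *m y j) <= \sum_(j < N.+1) 1 * fro (y j).
  apply: le_trans (fro_sum _ _ _) _; apply: ler_sum => b _; rewrite mul1r.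
  by rewrite ler_sqrt ?fro2_ge0 // -[leRHS]mul1r; apply: bnd_mulmxl; exact: bnd1X.
have h3 : fro2 (\sum_(j < N.+1) T ^+ j *m y j) <= (\sum_(j < N.+1) 1 * fro (y j)) ^+ 2.
  by rewrite -fro_le // (le_trans (fro_ge0 _) h2).
apply: (le_trans h3); apply: (le_trans (sum_cauchy_schwarz _ _ _)).
under [X in X * _]eq_bigr => b _ do rewrite expr1n.
under [X in _ * X]eq_bigr => b _ do rewrite sqr_fro.
rewrite sumr_const card_ord.
apply: le_trans (ler_wpM2l (ler0n _ _) h1) _.
rewrite mulrA ler_wpM2r ?fro2_ge0 //.
have Nr : 1 <= N%:R :> R by rewrite ler1n.
have : 0 <= M ^+ 2 * (9 * N%:R ^+ 2 - 3 * N.+1%:R).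
  rewrite mulr_ge0 ?sqr_ge0 // -natr1; nra.
by rewrite !exprMn; lra.
Qed.

End MatrixCalculus.

Local Open Scope classical_set_scope.

(** * Compression to finite-dimensional subspaces *)

Section InnerProduct.
Variables (R : realType) (H : separable_hilbert R).
Local Notation C := R[i].
Implicit Types (x y : H) (e : nat -> H).
Local Notation ip := (@inner R H).

Lemma ipDl x y z : ip (x + y) z = ip x z + ip y z.
Proof. exact: linearDl. Qed.

Lemma ipZl a x z : ip (a *: x) z = a * ip x z.
Proof. exact: linearZl_LR. Qed.

Lemma ip_conj x y : ip y x = Num.conj (ip x y).
Proof. by rewrite hermC expr0 mul1r. Qed.

Lemma ip0l z : ip 0 z = 0.
Proof. by rewrite -(scale0r (0 : H)) ipZl mul0r. Qed.

Lemma ip0r z : ip z 0 = 0.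
Proof. by rewrite ip_conj ip0l rmorph0. Qed.

Lemma ipZr a x z : ip z (a *: x) = Num.conj a * ip z x.
Proof. by rewrite ip_conj ipZl rmorphM /= -ip_conj. Qed.

Lemma ipDr x y z : ip z (x + y) = ip z x + ip z y.
Proof. by rewrite ip_conj ipDl rmorphD /= -!ip_conj. Qed.

Lemma ipBl x y z : ip (x - y) z = ip x z - ip y z.
Proof. by rewrite ipDl -scaleN1r ipZl mulN1r. Qed.

Lemma ip_suml (I : Type) (r : seq I) (P : pred I) (F : I -> H) z :
  ip (\sum_(i <- r | P i) F i) z = \sum_(i <- r | P i) ip (F i) z.
Proof.
by apply: (big_morph (fun x => ip x z)) => [x y|]; rewrite ?ipDl ?ip0l.
Qed.

Lemma ip_rnorm x : ip x x = (rnorm x ^+ 2)%:C.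
Proof. by rewrite inner_norm rmorphXn /= rnormE. Qed.

Lemma rnormZ a x : rnorm (a *: x) = rnorm a * rnorm x.
Proof. by apply: complexI; rewrite rmorphM /= !rnormE normrZ. Qed.

Lemma rnorm_pythagoras x y : ip x y = 0 -> rnorm (x + y) ^+ 2 = rnorm x ^+ 2 + rnorm y ^+ 2.
Proof.
move=> xy; apply: complexI; rewrite rmorphD /= -!ip_rnorm ipDl !ipDr xy.
by rewrite [ip y x]ip_conj xy rmorph0 addr0 add0r.
Qed.

Definition normalize x : H := (rnorm x)^-1%:C *: x.

Lemma normalizeK x : (rnorm x)%:C *: normalize x = x.
Proof.
have [->|x0] := eqVneq x 0; first by rewrite /normalize !scaler0.
by rewrite scalerA -rmorphM /= mulfV ?rnorm_eq0 // rmorph1 scale1r.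
Qed.

Lemma ip_normalize x : ip x (normalize x) = (rnorm x)%:C.
Proof.
have [->|x0] := eqVneq x 0; first by rewrite ip0l rnorm0 rmorph0.
rewrite ipZr conj_Creal ?complex_real // ip_rnorm -rmorphM /=; congr (_%:C).
by rewrite expr2 mulrA mulVf ?rnorm_eq0 // mul1r.
Qed.

Lemma normalize_eq0 x : (normalize x == 0) = (x == 0).
Proof.
apply/eqP/eqP => [h|->]; last by rewrite /normalize scaler0.
by rewrite -(normalizeK x) h scaler0.
Qed.

(* Orthonormal up to zero vectors, so that the Gram-Schmidt process applies to
   linearly dependent families. *)
Definition orthonormal0 e n := forall i j, (i < n)%N -> (j < n)%N ->
  ip (e i) (e j) = ((i == j) && (e i != 0))%:R.

Definition emb n e (y : 'cV[C]_n) : H := \sum_(i < n) y i 0 *: e i.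
Definition coo n e x : 'cV[C]_n := \col_(i < n) ip x (e i).

Lemma embD n e (y z : 'cV[C]_n) : emb e (y + z) = emb e y + emb e z.
Proof. by rewrite -big_split; apply: eq_bigr => i _; rewrite mxE scalerDl. Qed.

Lemma embZ n e a (y : 'cV[C]_n) : emb e (a *: y) = a *: emb e y.
Proof. by rewrite scaler_sumr; apply: eq_bigr => i _; rewrite mxE scalerA. Qed.

Lemma cooD n e x y : coo n e (x + y) = coo n e x + coo n e y.
Proof. by apply/colP => i; rewrite !mxE ipDl. Qed.

Lemma cooZ n e a x : coo n e (a *: x) = a *: coo n e x.
Proof. by apply/colP => i; rewrite !mxE ipZl. Qed.

Lemma coo0 n e : coo n e 0 = 0.
Proof. by apply/colP => i; rewrite !mxE ip0l. Qed.

Lemma emb0 n e : emb e (0 : 'cV[C]_n) = 0.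
Proof. by rewrite /emb big1 // => i _; rewrite mxE scale0r. Qed.

Lemma cooB n e x y : coo n e (x - y) = coo n e x - coo n e y.
Proof. by apply/colP => i; rewrite !mxE ipBl. Qed.

Lemma coo_sum n e (I : Type) (r : seq I) (P : pred I) (F : I -> H) :
  coo n e (\sum_(i <- r | P i) F i) = \sum_(i <- r | P i) coo n e (F i).
Proof. by apply: (big_morph (coo n e)) => [x y|]; rewrite ?cooD ?coo0. Qed.

Lemma emb_sum n e (I : Type) (r : seq I) (P : pred I) (F : I -> 'cV[C]_n) :
  emb e (\sum_(i <- r | P i) F i) = \sum_(i <- r | P i) emb e (F i).
Proof. by apply: (big_morph (emb e)) => [x y|]; rewrite ?embD ?emb0. Qed.

Lemma ip_emb n e (y : 'cV[C]_n) x : ip (emb e y) x = ((coo n e x)^t* *m y) 0 0.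
Proof.
rewrite ip_suml mxE; apply: eq_bigr => i _.
by rewrite ipZl !mxE [ip (e i) x]ip_conj mulrC.
Qed.

Section Orthonormal.
Variables (e : nat -> H) (n : nat).
Hypothesis he : orthonormal0 e n.

Lemma ip_emb_e (y : 'cV[C]_n) (j : 'I_n) :
  ip (emb e y) (e j) = y j 0 * (e j != 0)%:R.
Proof.
rewrite ip_suml (bigD1 j) //= ipZl he // eqxx big1 ?addr0 // => i ij.
have /negPf h : (i : nat) != j by [].
by rewrite ipZl he // h mulr0.
Qed.

Lemma rnorm_emb_le (y : 'cV[C]_n) : rnorm (emb e y) ^+ 2 <= fro2 y.
Proof.
have -> : rnorm (emb e y) ^+ 2 = \sum_(i < n) rnorm (y i 0) ^+ 2 * (e i != 0)%:R.
  apply: complexI; rewrite -ip_rnorm {1}/emb ip_suml rmorph_sum; apply: eq_bigr => i _ /=.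
  rewrite ipZl ip_conj ip_emb_e rmorphM /= rmorphM /= sqr_rnorm mulrA.
  by rewrite !rmorph_nat.
rewrite fro2_cV; apply: ler_sum => i _.
by case: (e i != 0); rewrite ?mulr1 // mulr0 sqr_ge0.
Qed.

Lemma ip_coo_compl x (j : 'I_n) : ip (x - emb e (coo n e x)) (e j) = 0.
Proof.
rewrite ipBl ip_emb_e mxE; have [->|_] := eqVneq (e j) 0.
  by rewrite ip0r mul0r subr0.
by rewrite mulr1 subrr.
Qed.

Lemma ip_emb_compl x (y : 'cV[C]_n) : ip (x - emb e (coo n e x)) (emb e y) = 0.
Proof.
rewrite ip_conj ip_suml rmorph_sum big1 //= => i _.
by rewrite ipZl rmorphM /= -ip_conj ip_coo_compl mulr0.
Qed.

Lemma bessel_identity x :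
  rnorm x ^+ 2 = rnorm (x - emb e (coo n e x)) ^+ 2 + fro2 (coo n e x).
Proof.
have := rnorm_pythagoras (ip_emb_compl x (coo n e x)); rewrite subrK => ->.
suff -> : rnorm (emb e (coo n e x)) ^+ 2 = fro2 (coo n e x) by [].
apply: complexI; rewrite -ip_rnorm {1}/emb ip_suml fro2_cV rmorph_sum.
apply: eq_bigr => i _ /=; rewrite ipZl ip_conj ip_emb_e rmorphM /= sqr_rnorm !mxE.
have [->|_] := eqVneq (e i) 0; last by rewrite rmorph1 mulr1.
by rewrite ip0r !mul0r.
Qed.

Lemma fro2_coo_le x : fro2 (coo n e x) <= rnorm x ^+ 2.
Proof. by rewrite bessel_identity lerDr sqr_ge0. Qed.

Lemma rnorm_compl_le x : rnorm (x - emb e (coo n e x)) <= rnorm x.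
Proof.
rewrite -(@ler_pXn2r _ 2) ?nnegrE ?rnorm_ge0 //.
by rewrite [leRHS]bessel_identity lerDl fro2_ge0.
Qed.

Lemma emb_coo_e (i : nat) : (i < n)%N -> emb e (coo n e (e i)) = e i.
Proof.
move=> hi; rewrite /emb (bigD1 (Ordinal hi)) //= mxE he //= eqxx /=.
rewrite big1 ?addr0 => [|j ji].
  by have [->|_] := eqVneq (e i) 0; rewrite ?scaler0 // scale1r.
have /negPf h : (i : nat) != j by rewrite eq_sym; move: ji; rewrite -val_eqE.
by rewrite mxE he // h scale0r.
Qed.

Lemma orthonormal0_rcons x : let r := x - emb e (coo n e x) in
  orthonormal0 (fun k => if k == n then normalize r else e k) n.+1.
Proof.
move=> r; have rE (j : 'I_n) : ip r (e j) = 0 by exact: ip_coo_compl.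
have nr : ip (normalize r) (normalize r) = (normalize r != 0)%:R.
  rewrite ipZl ip_normalize -rmorphM /= normalize_eq0.
  have [->|r0] := eqVneq r 0; first by rewrite rnorm0 mulr0.
  by rewrite mulVf ?rnorm_eq0.
move=> i j; rewrite !ltnS => hi hj.
have lt_n k : k != n -> (k <= n)%N -> (k < n)%N by rewrite ltn_neqAle => ->.
case: (eqVneq i n) => [ei|ni]; case: (eqVneq j n) => [ej|nj].
- by rewrite nr ei ej eqxx.
- by rewrite ipZl (rE (Ordinal (lt_n j nj hj))) mulr0 ei eq_sym (negPf nj).
- by rewrite ip_conj ipZl (rE (Ordinal (lt_n i ni hi))) mulr0 rmorph0 ej (negPf ni).
- by rewrite he // lt_n.
Qed.

End Orthonormal.

Definition spanned n e x := emb e (coo n e x) = x.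

Lemma spannedD n e x y : spanned n e x -> spanned n e y -> spanned n e (x + y).
Proof. by rewrite /spanned cooD embD => -> ->. Qed.

Lemma spannedZ n e a x : spanned n e x -> spanned n e (a *: x).
Proof. by rewrite /spanned cooZ embZ => ->. Qed.

Lemma spanned_sum n e (I : Type) (r : seq I) (P : pred I) (F : I -> H) :
  (forall i, P i -> spanned n e (F i)) -> spanned n e (\sum_(i <- r | P i) F i).
Proof.
move=> h; elim/big_ind: _ => //; last exact: spannedD.
by rewrite /spanned coo0 emb0.
Qed.

Lemma gram_schmidt (X : seq H) : exists e,
  orthonormal0 e (size X) /\ forall x, x \in X -> spanned (size X) e x.
Proof.
elim/last_ind: X => [|X x [e [he hX]]]; first by exists (fun=> 0); split.
rewrite size_rcons; set n := size X in he hX *.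
pose r := x - emb e (coo n e x).
pose e' := fun k => if k == n then normalize r else e k.
have he' : orthonormal0 e' n.+1 by exact: orthonormal0_rcons.
have sp i : (i < n)%N -> spanned n.+1 e' (e i).
  move=> hi; have -> : e i = e' i by rewrite /e' (ltn_eqF hi).
  by apply: (emb_coo_e he'); rewrite ltnS ltnW.
have spX y : spanned n e y -> spanned n.+1 e' y.
  by move=> <-; apply: spanned_sum => i _; apply: spannedZ; exact: sp.
exists e'; split=> // y; rewrite mem_rcons inE => /predU1P[->|/hX]; last exact: spX.
rewrite -[x](subrK (emb e (coo n e x))) -/r; apply: spannedD.
  rewrite -(normalizeK r); apply: spannedZ.
  have -> : normalize r = e' n by rewrite /e' eqxx.
  exact: (emb_coo_e he').
by apply: spanned_sum => i _; apply: spannedZ; exact: sp.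
Qed.

End InnerProduct.

(** * Singular values *)

Section OperatorNorm.
Variables (R : realType) (H : separable_hilbert R).
Local Notation C := R[i].
Local Notation ip := (@inner R H).
Implicit Types (A K T S : H -> H) (x : H).

Section Linear.
Variable A : H -> H.
Hypothesis linA : linear A.

Lemma linear_opD x y : A (x + y) = A x + A y.
Proof. by rewrite -[x]scale1r linA !scale1r. Qed.

Lemma linear_op0 : A 0 = 0.
Proof. by apply: (addrI (A 0)); rewrite -linear_opD !addr0. Qed.

Lemma linear_opZ a x : A (a *: x) = a *: A x.
Proof. by rewrite -[a *: x]addr0 linA linear_op0 addr0. Qed.

Lemma linear_opB x y : A (x - y) = A x - A y.
Proof. by rewrite -scaleN1r linear_opD linear_opZ scaleN1r. Qed.

Lemma linear_op_sum (I : Type) (r : seq I) (P : pred I) (F : I -> H) :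
  A (\sum_(i <- r | P i) F i) = \sum_(i <- r | P i) A (F i).
Proof. by apply: (big_morph A) => [x y|]; [exact: linear_opD|exact: linear_op0]. Qed.

Lemma linear_iter n : linear (iter n A).
Proof. by elim: n => // n IHn a x y; rewrite !iterS IHn linA. Qed.

End Linear.

Lemma linear_sub A K : linear A -> linear K -> linear (A \- K).
Proof.
by move=> hA hK a x y; rewrite /= hA hK scalerBr opprD addrACA.
Qed.

Lemma opnorm_ub A x : rnorm x <= 1 -> ((rnorm (A x))%:E <= opnorm A)%E.
Proof. by move=> x1; apply: ereal_sup_ubound; exists x. Qed.

Lemma opnorm_ge0 A : (0 <= opnorm A)%E.
Proof.
have h : rnorm (0 : H) <= 1 by rewrite rnorm0.
by apply: le_trans (opnorm_ub A h); rewrite lee_fin rnorm_ge0.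
Qed.

Lemma opnorm_le A (c : R) : 0 <= c -> (forall x, rnorm (A x) <= c * rnorm x) ->
  (opnorm A <= c%:E)%E.
Proof.
move=> c0 hA; apply: ge_ereal_sup => _ [x /= x1 <-]; rewrite lee_fin.
by apply: le_trans (hA x) _; rewrite ler_piMr.
Qed.

Lemma rnorm_op_le A (c : R) x : linear A -> (opnorm A <= c%:E)%E ->
  rnorm (A x) <= c * rnorm x.
Proof.
move=> linA hc; have [->|x0] := eqVneq x 0.
  by rewrite linear_op0 // !rnorm0 mulr0.
have n0 : 0 < rnorm x by rewrite lt_neqAle rnorm_ge0 eq_sym rnorm_eq0 x0.
have h1 : rnorm (normalize x) <= 1.
  by rewrite rnormZ rnorm_real ?invr_ge0 ?rnorm_ge0 // mulVf // gt_eqF.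
have := le_trans (opnorm_ub A h1) hc; rewrite lee_fin linear_opZ // rnormZ.
by rewrite rnorm_real ?invr_ge0 ?rnorm_ge0 // mulrC ler_pdivrMr.
Qed.

Lemma bounded_operatorP A : bounded_operator A <->
  linear A /\ exists2 c : R, 0 <= c & forall x, rnorm (A x) <= c * rnorm x.
Proof.
split=> [[linA hA]|[linA [c c0 hc]]]; last first.
  by split=> //; apply: le_lt_trans (opnorm_le c0 hc) (ltry _).
split=> //; have := opnorm_ge0 A.
case: (opnorm A) hA (@rnorm_op_le A) => // c _ hc c0.
by exists c => // x; apply: hc.
Qed.

Lemma bounded_operator_sub A K :
  bounded_operator A -> bounded_operator K -> bounded_operator (A \- K).
Proof.
move=> /bounded_operatorP[linA [a a0 ha]] /bounded_operatorP[linK [k k0 hk]].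
apply/bounded_operatorP; split; first exact: linear_sub.
exists (a + k); first exact: addr_ge0.
by move=> x; apply: le_trans (rnormB _ _) _; rewrite mulrDl lerD.
Qed.

Lemma contraction_rnorm T : contraction_operator T ->
  linear T /\ forall x, rnorm (T x) <= rnorm x.
Proof.
move=> [linT hT]; split=> // x; rewrite -[leRHS]mul1r; exact: rnorm_op_le.
Qed.

Lemma bounded_contraction T : contraction_operator T -> bounded_operator T.
Proof. by move=> [linT hT]; split=> //; apply: le_lt_trans hT (ltry _). Qed.

Lemma singular_value_ge0 n A : (0 <= singular_value n A)%E.
Proof. by apply: le_ereal_inf_tmp => _ [K _ <-]; exact: opnorm_ge0. Qed.

Lemma singular_value_le_opnorm n A : (singular_value n A <= opnorm A)%E.
Proof.
apply: ereal_inf_lbound; exists (fun=> 0); last first.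
  by congr opnorm; apply/funext => x /=; rewrite subr0.
split.
  apply/bounded_operatorP; split; first by move=> a x y; rewrite scaler0 addr0.
  by exists 0 => // x; rewrite rnorm0 mul0r.
by exists (fun=> 0) => x; exists (fun=> 0); rewrite big1 // => i _; rewrite scaler0.
Qed.

Lemma singular_value_nonincreasing m n A : (m <= n)%N ->
  (singular_value n A <= singular_value m A)%E.
Proof.
move=> mn; apply: le_ereal_inf => _ [K [bK [v hv]] <-]; exists K => //; split=> //.
exists (fun i : 'I_n => if insub (i : nat) is Some j then v j else 0) => x.
have [c hc] := hv x; exists (fun i : 'I_n => if insub (i : nat) is Some j then c j else 0).
rewrite hc (bigID (fun i : 'I_n => (i < m)%N)) /= [X in _ = _ + X]big1 ?addr0; last first.
  by move=> i im; rewrite insubN //= scaler0.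
rewrite (big_ord_narrow mn); apply: eq_bigr => i _ /=.
by rewrite valK.
Qed.

Lemma singular_value_fin n A : bounded_operator A -> singular_value n A \is a fin_num.
Proof.
move=> [_ bA]; rewrite ge0_fin_numE ?singular_value_ge0 //.
exact: le_lt_trans (singular_value_le_opnorm n A) bA.
Qed.

Definition op_mx n (e : nat -> H) T : 'M[C]_n := \matrix_(i < n, j < n) ip (T (e j)) (e i).

Section Compression.
Variables (e : nat -> H) (n : nat).
Hypothesis he : orthonormal0 e n.

Lemma op_mxE T (y : 'cV[C]_n) : linear T -> op_mx n e T *m y = coo n e (T (emb e y)).
Proof.
move=> linT; rewrite (linear_op_sum linT) coo_sum.
apply/colP => i; rewrite summxE !mxE; apply: eq_bigr => j _.
by rewrite linear_opZ // !mxE ipZl mulrC.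
Qed.

Lemma op_mx_coo T x : linear T -> spanned n e x -> coo n e (T x) = op_mx n e T *m coo n e x.
Proof. by move=> linT hx; rewrite op_mxE // hx. Qed.

Lemma op_mx_contraction T : contraction_operator T -> bnd 1 (op_mx n e T).
Proof.
move=> /contraction_rnorm[linT hT] y; rewrite mul1r op_mxE //.
apply: le_trans (fro2_coo_le he _) _; apply: le_trans (rnorm_emb_le he y).
by rewrite lerXn2r ?nnegrE ?rnorm_ge0.
Qed.

Lemma op_mx_sub T S : op_mx n e (T \- S) = op_mx n e T - op_mx n e S.
Proof. by apply/matrixP => i j; rewrite !mxE ipBl. Qed.

(** Compression is not multiplicative. It is exact as long as each vector to which T is applied lies
    in the span, hence the condition for l < k only. *)
Lemma op_mx_iter T k x : linear T -> (forall l, (l < k)%N -> spanned n e (iter l T x)) ->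
  coo n e (iter k T x) = op_mx n e T ^+ k *m coo n e x.
Proof.
move=> linT; elim: k => [|k IHk] hk; first by rewrite expr0 mul1mx.
rewrite iterS (op_mx_coo linT (hk k (ltnSn k))) IHk; last by move=> l lk; apply: hk; rewrite ltnW.
by rewrite mulmxA exprS.
Qed.

(** Dimension count: an operator K of rank at most k kills some nonzero vector of the
    (k+1)-dimensional space given by X. There A and A - K agree, so c is at most the norm of A - K,
    for every competitor K. *)
Lemma op_mx_dominates A : bounded_operator A ->
  dominates_singular_values (op_mx n e A) (fun k => fine (singular_value k A)).
Proof.
move=> bA k X c c0 XX hX; have [linA _] := bA.
rewrite -lee_fin fineK ?singular_value_fin //.
apply: le_ereal_inf_tmp => _ [K [bK [v hv]] <-]; have [linK _] := bK.
pose b (j : 'I_k.+1) : H := emb e (X *m delta_mx j 0).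
pose cf (j : 'I_k.+1) := sval (cid (hv (b j))).
have hcf j : K (b j) = \sum_(i < k) cf j i *: v i by exact: (svalP (cid (hv (b j)))).
pose M : 'M[C]_(k.+1, k) := \matrix_(j, i) cf j i.
(* M has k + 1 rows and k columns, so its rows are dependent; a dependency gives the vector killed
   by K. *)
have : (0 < \rank (kermx M))%N.
  by rewrite mxrank_ker subn_gt0; apply: leq_ltn_trans (rank_leq_col M) _.
rewrite lt0n mxrank_eq0 => /rowV0Pn[y0 /sub_kermxP yM y0_neq0].
pose y := y0^T.
have Ky : K (emb e (X *m y)) = 0.
  have -> : emb e (X *m y) = \sum_j y j 0 *: b j.
    rewrite /b; under eq_bigr => j _ do rewrite -embZ scalemxAr.
    rewrite -emb_sum -mulmx_sumr; congr (emb e (X *m _)).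
    apply/colP => j; rewrite summxE (bigD1 j) //= !mxE !eqxx mulr1 big1 ?addr0 // => l lj.
    by rewrite !mxE eq_sym (negPf lj) mulr0.
  rewrite (linear_op_sum linK).
  under eq_bigr => j _.
    rewrite linear_opZ // hcf scaler_sumr.
    under eq_bigr => i _ do rewrite scalerA.
    over.
  rewrite exchange_big big1 // => i _ /=; rewrite -scaler_suml.
  have /rowP/(_ i) := yM; rewrite !mxE => h.
  rewrite (_ : \sum_j _ = 0) ?scale0r // -[RHS]h.
  by apply: eq_bigr => j _; rewrite !mxE.
have y_gt0 : 0 < fro2 y.
  rewrite lt_neqAle fro2_ge0 andbT eq_sym; apply: contra y0_neq0 => /eqP h.
  apply/eqP/rowP => j; rewrite !mxE; apply/eqP; rewrite -rnorm_eq0 -sqrf_eq0.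
  have := h; rewrite fro2_cV => /eqP; rewrite psumr_eq0; last by move=> *; exact: sqr_ge0.
  by move=> /allP/(_ j); rewrite mem_index_enum !mxE => /(_ erefl).
have Xy : fro2 (X *m y) = fro2 y.
  apply: complexI; rewrite fro2_mul_tr XX mulmx1 fro2_tr mxtrace_mulC.
  by [].
have bAK := bounded_operator_sub bA bK.
have linAK := bAK.1.
case: (opnorm (A \- K)) (opnorm_ge0 (A \- K)) bAK.2 (@rnorm_op_le (A \- K)) => // o o0 _ ho.
rewrite lee_fin in o0 *; rewrite lee_fin.
rewrite -(@ler_pXn2r _ 2) ?nnegrE // -(ler_pM2r y_gt0).
apply: le_trans (hX y) _; rewrite op_mxE //.
apply: le_trans (fro2_coo_le he _) _.
have -> : A (emb e (X *m y)) = (A \- K) (emb e (X *m y)) by rewrite /= Ky subr0.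
apply: (@le_trans _ _ ((o * rnorm (emb e (X *m y))) ^+ 2)).
  by rewrite lerXn2r ?nnegrE ?mulr_ge0 ?rnorm_ge0 // ho.
by rewrite exprMn ler_wpM2l ?sqr_ge0 // -Xy; exact: rnorm_emb_le.
Qed.

End Compression.

End OperatorNorm.

(** * Recovering singular values from matrix coefficients *)

Section Greedy.
Variables (R : realType) (H : separable_hilbert R).
Local Notation C := R[i].
Local Notation ip := (@inner R H).

Lemma linear_emb_coo n (e : nat -> H) : linear (fun x => emb e (coo n e x)).
Proof. by move=> a x y; rewrite cooD cooZ embD embZ. Qed.

Lemma almost_opnorm (A : H -> H) : bounded_operator A -> (0 < opnorm A)%E ->
  exists x, [/\ rnorm x <= 1, 0 < rnorm (A x) & (opnorm A <= (2 * rnorm (A x))%:E)%E].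
Proof.
move=> [_ bA] A0; move: A0 bA; case eo: (opnorm A) => [c||] // c0 _; rewrite lte_fin in c0.
have : ((c / 2)%:E < opnorm A)%E by rewrite eo lte_fin; lra.
move=> /ereal_sup_gt[_ [x /= x1 <-]]; rewrite lte_fin => h.
by exists x; split=> //; rewrite ?lee_fin; lra.
Qed.

(* Each step takes a near-maximiser of the compression of [D] to the orthogonal
   complements of the vectors already chosen; that compression differs from
   [D] by an operator of rank at most twice their number. *)
Lemma greedy_singular_vectors (D : H -> H) n : bounded_operator D ->
  exists e f : nat -> H, [/\ orthonormal0 e n, orthonormal0 f n &
    forall k, (k < n)%N ->
      (singular_value (k + k) D <= (2 * rnorm (ip (D (e k)) (f k)))%:E)%E].
Proof.
move=> bD; have [linD [c c0 hc]] := (bounded_operatorP D).1 bD.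
elim: n => [|n [e [f [he hf hef]]]]; first by exists (fun _ => 0), (fun _ => 0); split.
pose P x := emb e (coo n e x); pose Q x := emb f (coo n f x).
pose D' x := D (x - P x) - Q (D (x - P x)).
have linP : linear P by exact: linear_emb_coo.
have linQ : linear Q by exact: linear_emb_coo.
have linD' : linear D'.
  have hl : linear (fun x => D (x - P x)).
    by move=> a x y; rewrite -linD linP scalerBr opprD addrACA.
  by move=> a x y; rewrite /D' hl linQ scalerBr opprD addrACA.
have hD' x : rnorm (D' x) <= c * rnorm x.
  apply: le_trans (rnorm_compl_le hf _) _; apply: le_trans (hc _) _.
  by rewrite ler_wpM2l // rnorm_compl_le.
have bD' : bounded_operator D' by apply/bounded_operatorP; split=> //; exists c.
(* D - D' = D P + Q D (1 - P) has range in the span of the n vectors D e_j and the n vectors f_j,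
   whence the index n + n. *)
have rank_le_opnorm : (singular_value (n + n) D <= opnorm D')%E.
  apply: ereal_inf_lbound; exists (D \- D'); last first.
    by congr opnorm; apply/funext => x /=; rewrite opprB addrC subrK.
  split; first exact: bounded_operator_sub.
  exists (fun i : 'I_(n + n) => match fintype.split i with inl j => D (e j) | inr j => f j end) => x.
  exists (fun i : 'I_(n + n) => match fintype.split i with
    inl j => coo n e x j 0 | inr j => coo n f (D (x - P x)) j 0 end).
  have -> : (D \- D') x = D (P x) + Q (D (x - P x)).
    have -> : D (P x) = D x - D (x - P x) by rewrite (linear_opB linD) opprB addrC subrK.
    by rewrite /= /D' opprB addrA addrAC.
  rewrite big_split_ord /=; congr (_ + _).
    rewrite /P /emb linear_op_sum //; apply: eq_bigr => j _.
    by rewrite linear_opZ // -[lshift n j]/(unsplit (inl j)) unsplitK.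
  by apply: eq_bigr => j _; rewrite -[rshift n j]/(unsplit (inr j)) unsplitK.
have [x [z [hx hz hxz]]] : exists x z, [/\ orthonormal0 (fun k => if k == n then x else e k) n.+1,
    orthonormal0 (fun k => if k == n then z else f k) n.+1 &
    (opnorm D' <= (2 * rnorm (ip (D x) z))%:E)%E].
  have [D'0|D'0] := leP (opnorm D') 0%E.
    exists 0, 0; split.
    - have := orthonormal0_rcons he 0; rewrite coo0 emb0 subr0 /normalize scaler0; exact.
    - have := orthonormal0_rcons hf 0; rewrite coo0 emb0 subr0 /normalize scaler0; exact.
    by rewrite ip0r rnorm0 mulr0.
  have [x [x1 D'x hD'x]] := almost_opnorm bD' D'0.
  pose r := x - P x; pose s := D' x.
  exists (normalize r), (normalize s); split.
  - exact: orthonormal0_rcons.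
  - exact: (orthonormal0_rcons hf (D r)).
  apply: le_trans hD'x _; rewrite lee_fin ler_wpM2l //.
  have r0 : r != 0.
    apply/negP => /eqP h; move: D'x; rewrite /D' -/r h linear_op0 // /Q coo0 emb0 subr0.
    by rewrite rnorm0 ltxx.
  have rn0 : 0 < rnorm r by rewrite lt_neqAle rnorm_ge0 eq_sym rnorm_eq0 r0.
  (* Here s = D r - Q (D r) is orthogonal to the range of Q, so pairing D r with the normalised s
     gives |s|. Since |r| <= 1, normalising r can only increase this. *)
  have ips : ip (D r) (normalize s) = (rnorm s)%:C.
    rewrite -[D r](subrK (Q (D r))) -/(D' x) -/s ipDl ip_normalize.
    rewrite [ip (Q _) _]ip_conj ipZl ip_emb_compl //.
    by rewrite mulr0 rmorph0 addr0.
  rewrite linear_opZ // ipZl ips -rmorphM /= rnorm_real; last first.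
    by rewrite mulr_ge0 ?invr_ge0 ?rnorm_ge0.
  rewrite -/s mulrC ler_pdivlMr // ler_piMr ?rnorm_ge0 //.
  exact: le_trans (rnorm_compl_le he x) x1.
exists (fun k => if k == n then x else e k), (fun k => if k == n then z else f k); split=> //.
move=> k; rewrite ltnS leq_eqVlt; have [->|kn] := eqVneq k n.
  by move=> _; apply: le_trans rank_le_opnorm hxz.
exact: hef.
Qed.

End Greedy.

(** * From operators to matrices *)

Section Transfer.
Variables (R : realType) (H : separable_hilbert R).
Local Notation C := R[i].
Local Notation ip := (@inner R H).
Implicit Types (T S : H -> H) (x : H) (g : nat -> nat -> C).

Definition op_calc N g T S x : H :=
  \sum_(j < N.+1) iter j T (\sum_(k < N.+1) g j k *: iter k S x).

(** These contain every intermediate vector of the calculus at x. The list is finite, so compressing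
    to its span computes [op_calc] at x exactly. *)
Definition words N T S x := [seq iter j T (iter k S x) | j <- iota 0 N.+1, k <- iota 0 N.+1].

Lemma mem_words N T S x j k : (j <= N)%N -> (k <= N)%N ->
  iter j T (iter k S x) \in words N T S x.
Proof. by move=> hj hk; apply/allpairsP; exists (j, k); rewrite !mem_iota add0n !ltnS. Qed.

Section Coordinates.
Variables (d : nat) (b : nat -> H) (L : nat) (T S : H -> H) (x : H).
Hypotheses (linT : linear T) (linS : linear S).
Hypothesis hW : forall y, y \in words L T S x -> spanned d b y.

Lemma op_calc_spanned N g : (N <= L)%N -> spanned d b (op_calc N g T S x).
Proof.
move=> NL; apply: spanned_sum => j _.
rewrite (linear_op_sum (linear_iter linT j)); apply: spanned_sum => k _.
rewrite (linear_opZ (linear_iter linT j)); apply: spannedZ; apply: hW.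
by apply: mem_words; apply: leq_trans NL; rewrite -ltnS.
Qed.

Lemma coo_op_calc N g : (N <= L)%N ->
  coo d b (op_calc N g T S x) = mx_calc N g (op_mx d b T) (op_mx d b S) *m coo d b x.
Proof.
move=> NL; have le_L (j : 'I_N.+1) : (j <= L)%N by apply: leq_trans NL; rewrite -ltnS.
rewrite /op_calc coo_sum /mx_calc mulmx_suml; apply: eq_bigr => j _.
rewrite (linear_op_sum (linear_iter linT j)) coo_sum -mulmxA mulmx_suml mulmx_sumr.
apply: eq_bigr => k _.
rewrite (linear_opZ (linear_iter linT j)) cooZ op_mx_iter //; last first.
  move=> l lj; apply: hW; apply: mem_words => //.
  exact: ltnW (leq_trans lj (le_L j)).
rewrite op_mx_iter //; last first.
  move=> l lk; apply: hW; apply: (mem_words T S x (j := 0)) => //.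
  exact: ltnW (leq_trans lk (le_L k)).
by rewrite -scalemxAl scalemxAr.
Qed.

End Coordinates.

Lemma op_calc_rnorm N g M T S x : (0 < N)%N -> torus_bound N g M ->
  contraction_operator T -> contraction_operator S ->
  rnorm (op_calc N g T S x) <= 3 * N%:R * M * rnorm x.
Proof.
move=> N0 hg cT cS; have M0 := torus_bound_ge0 hg.
have [linT _] := contraction_rnorm cT; have [linS _] := contraction_rnorm cS.
have [b [hb hX]] := gram_schmidt (words N T S x).
rewrite -(@ler_pXn2r _ 2) ?nnegrE ?mulr_ge0 ?rnorm_ge0 // exprMn.
rewrite -(op_calc_spanned linT hX g (leqnn N)).
apply: le_trans (rnorm_emb_le hb _) _; rewrite (coo_op_calc linT linS hX) //.
apply: le_trans (mx_calc_bnd N0 hg (op_mx_contraction hb cT) (op_mx_contraction hb cS) _) _.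
by rewrite ler_wpM2l ?sqr_ge0 // fro2_coo_le.
Qed.

Definition family_mx d n (b e : nat -> H) : 'M[C]_(d, n) :=
  \matrix_(a < d, i < n) ip (e i) (b a).

Lemma family_mx_bnd d n b e : orthonormal0 b d -> orthonormal0 e n ->
  bnd 1 (family_mx d n b e).
Proof.
move=> hb he y; rewrite mul1r.
have -> : family_mx d n b e *m y = coo d b (emb e y).
  rewrite coo_sum; apply/colP => a; rewrite summxE mxE; apply: eq_bigr => i _.
  by rewrite !mxE ipZl mulrC.
by apply: le_trans (fro2_coo_le hb _) _; exact: rnorm_emb_le.
Qed.

Lemma powR_add_le (p a b : R) : 1 <= p <= 2 -> 0 <= a -> 0 <= b ->
  (a + b) `^ p <= 4 * (a `^ p + b `^ p).
Proof.
move=> /andP[p1 p2] a0 b0; have p0 : 0 <= p by lra.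
have h c : 0 <= c -> (2 * c) `^ p <= 4 * c `^ p.
  move=> c0; rewrite powRM // ler_wpM2r ?powR_ge0 //.
  have -> : 4 = 2 `^ 2 :> R by rewrite -[2 in X in _ `^ X]/(2%:R) powR_mulrn //; ring.
  by apply: ler_powR => //; lra.
have pa := powR_ge0 a p; have pb := powR_ge0 b p.
have [ab|ba] := leP a b.
  apply: (@le_trans _ _ ((2 * b) `^ p)).
    by apply: ge0_ler_powR; rewrite ?nnegrE //; lra.
  by have := h b b0; lra.
apply: (@le_trans _ _ ((2 * a) `^ p)).
  by apply: ge0_ler_powR; rewrite ?nnegrE //; lra.
by have := h a a0; lra.
Qed.

(** All m polynomials and all n vectors are compressed to one common space. The blocks are added
    before interpolating, as maps Phi and Psi with summed constants, so no triangle inequality in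
    S_p is needed. The change passes through (T0, S1), giving one term per variable. 16 is 4 for
    separating these two terms times 4 from interpolation; d depends on the vectors, but the partial
    sums on the right will be bounded uniformly in it. *)
Lemma op_calc_difference_bound (N : nat -> nat) (g : nat -> nat -> nat -> C) (M : nat -> R)
    m (T1 S1 T0 S0 : H -> H) (p : R) n (e f : nat -> H) :
  1 <= p <= 2 -> (forall i, torus_bound (N i) (g i) (M i)) ->
  contraction_operator T1 -> contraction_operator S1 ->
  contraction_operator T0 -> contraction_operator S0 ->
  orthonormal0 e n -> orthonormal0 f n ->
  exists d, \sum_(i < n) rnorm (ip (\sum_(k < m)
      (op_calc (N k) (g k) T1 S1 (e i) - op_calc (N k) (g k) T0 S0 (e i))) (f i)) `^ p <=
    16 * ((\sum_(k < m) 3 * (N k)%:R * M k) `^ p *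
      (\sum_(k < d) fine (singular_value k (T1 \- T0)) `^ p +
       \sum_(k < d) fine (singular_value k (S1 \- S0)) `^ p)).
Proof.
move=> hp hg cT1 cS1 cT0 cS0 he hf.
have [linT1 _] := contraction_rnorm cT1; have [linS1 _] := contraction_rnorm cS1.
have [linT0 _] := contraction_rnorm cT0; have [linS0 _] := contraction_rnorm cS0.
pose L := (\sum_(k < m) N k)%N.
have NL (k : 'I_m) : (N k <= L)%N by rewrite /L (bigD1 k) //= leq_addr.
pose X := [seq x | i <- iota 0 n, x <- words L T1 S1 (e i) ++ words L T0 S0 (e i)].
have [b [hb hX]] := gram_schmidt X; set d := size X in hb hX.
have memX i x : (i < n)%N -> x \in words L T1 S1 (e i) ++ words L T0 S0 (e i) -> x \in X.
  move=> hi hx; apply/allpairsPdep; exists i, x; split=> //.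
  by rewrite mem_iota add0n.
have h1 i : (i < n)%N -> forall y, y \in words L T1 S1 (e i) -> spanned d b y.
  by move=> hi y hy; apply: hX; apply: (memX i) => //; rewrite mem_cat hy.
have h0 i : (i < n)%N -> forall y, y \in words L T0 S0 (e i) -> spanned d b y.
  by move=> hi y hy; apply: hX; apply: (memX i) => //; rewrite mem_cat hy orbT.
pose mT1 := op_mx d b T1; pose mS1 := op_mx d b S1.
pose mT0 := op_mx d b T0; pose mS0 := op_mx d b S0.
have bT1 : bnd 1 mT1 by exact: op_mx_contraction.
have bS1 : bnd 1 mS1 by exact: op_mx_contraction.
have bT0 : bnd 1 mT0 by exact: op_mx_contraction.
have bS0 : bnd 1 mS0 by exact: op_mx_contraction.
have exPhi k : {Phi | schatten12_bounded Phi (3 * (N k)%:R * M k) &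
    mx_calc (N k) (g k) mT1 mS1 - mx_calc (N k) (g k) mT0 mS1 = Phi (mT1 - mT0)}.
  apply: cid2; exact: mx_calc_diff_left (hg k) bT1 bT0 bS1.
have exPsi k : {Psi | schatten12_bounded Psi (3 * (N k)%:R * M k) &
    mx_calc (N k) (g k) mT0 mS1 - mx_calc (N k) (g k) mT0 mS0 = Psi (mS1 - mS0)}.
  apply: cid2; exact: mx_calc_diff_right (hg k) bT0 bS1 bS0.
pose Phi A := \sum_(k < m) s2val (exPhi k) A.
pose Psi A := \sum_(k < m) s2val (exPsi k) A.
pose K := \sum_(k < m) 3 * (N k)%:R * M k.
have bPhi : schatten12_bounded Phi K.
  exact: schatten12_bounded_sum (fun k => s2valP (exPhi k)).
have bPsi : schatten12_bounded Psi K.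
  exact: schatten12_bounded_sum (fun k => s2valP (exPsi k)).
pose E := family_mx d n b e; pose F := family_mx d n b f.
have bE : bnd 1 E by exact: family_mx_bnd.
have bF : bnd 1 F by exact: family_mx_bnd.
have eqD (i : 'I_n) : ip (\sum_(k < m)
      (op_calc (N k) (g k) T1 S1 (e i) - op_calc (N k) (g k) T0 S0 (e i))) (f i) =
    (F^t* *m Phi (mT1 - mT0) *m E) i i + (F^t* *m Psi (mS1 - mS0) *m E) i i.
  set D := \sum_(k < m) _.
  have spD : spanned d b D.
    apply: spanned_sum => k _; rewrite -scaleN1r; apply: spannedD.
      exact: (op_calc_spanned linT1 (h1 i _)).
    by apply: spannedZ; exact: (op_calc_spanned linT0 (h0 i _)).
  have cooDE : coo d b D = (Phi (mT1 - mT0) + Psi (mS1 - mS0)) *m coo d b (e i).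
    rewrite /D coo_sum /Phi /Psi -big_split mulmx_suml; apply: eq_bigr => k _ /=.
    rewrite -(s2valP' (exPhi k)) -(s2valP' (exPsi k)) addrA subrK mulmxBl cooB.
    by rewrite (coo_op_calc linT1 linS1 (h1 i _)) ?(coo_op_calc linT0 linS0 (h0 i _)).
  rewrite -spD ip_emb cooDE.
  have -> : coo d b (e i) = col i E by apply/colP => a; rewrite !mxE.
  have -> : coo d b (f i) = col i F by apply/colP => a; rewrite !mxE.
  transitivity ((F^t* *m (Phi (mT1 - mT0) + Psi (mS1 - mS0)) *m E) i i).
    rewrite -mulmxA [LHS]mxE [RHS]mxE; apply: eq_bigr => a _.
    rewrite !mxE; congr (_ * _); apply: eq_bigr => a' _.
    by rewrite !mxE.
  by rewrite mulmxDr mulmxDl [LHS]mxE.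
exists d; under eq_bigr => i _ do rewrite eqD.
apply: (@le_trans _ _ (\sum_(i < n) 4 * (rnorm ((F^t* *m Phi (mT1 - mT0) *m E) i i) `^ p +
    rnorm ((F^t* *m Psi (mS1 - mS0) *m E) i i) `^ p))).
  apply: ler_sum => i _; apply: le_trans (powR_add_le hp _ _); rewrite ?rnorm_ge0 //.
  apply: ge0_ler_powR; rewrite ?nnegrE ?addr_ge0 ?rnorm_ge0 ?rnormD //.
  by case/andP: hp => *; lra.
rewrite -mulr_sumr big_split /=.
have hT : dominates_singular_values (mT1 - mT0) (fun k => fine (singular_value k (T1 \- T0))).
  rewrite -op_mx_sub; apply: op_mx_dominates => //.
  by apply: bounded_operator_sub; exact: bounded_contraction.
have hS : dominates_singular_values (mS1 - mS0) (fun k => fine (singular_value k (S1 \- S0))).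
  rewrite -op_mx_sub; apply: op_mx_dominates => //.
  by apply: bounded_operator_sub; exact: bounded_contraction.
have k1 := schatten_interpolation hp bPhi hT bE bF.
have k2 := schatten_interpolation hp bPsi hS bE bF.
have := lerD k1 k2; rewrite -/K -!mulrDr => k12.
apply: le_trans (ler_wpM2l (ler0n R 4) k12) _.
by rewrite mulrA -natrM.
Qed.

End Transfer.

(** * Sup norm of a Littlewood-Paley block *)

Section SupNorm.
Variable R : realType.
Local Notation C := R[i].

Lemma expiD (s t : R) : expi (s + t) = expi s * expi t.
Proof.
rewrite /expi cosD sinD; apply/eqP; rewrite eq_complex /=.
by apply/andP; split; apply/eqP; ring.
Qed.

Lemma expi_nat (n : nat) (t : R) : expi (n%:R * t) = expi t ^+ n.
Proof.
elim: n => [|n IHn]; last by rewrite -natr1 mulrDl mul1r expiD IHn exprSr.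
by rewrite mul0r expr0 /expi cos0 sin0.
Qed.

Lemma unit_expi (z : C) : rnorm z = 1 -> exists2 t : R, 0 <= t <= 2 * pi & z = expi t.
Proof.
move=> z1; have h : complex.Re z ^+ 2 + complex.Im z ^+ 2 = 1.
  by apply: complexI; rewrite add_Re2_Im2 -rnormE z1 rmorph1 expr1n.
case: z z1 h => a b _ /= h.
have ha : -1 <= a <= 1 by apply/andP; split; have := sqr_ge0 b; nra.
have hs : sin (acos a) = `|b|.
  by rewrite sin_acos // -sqrtr_sqr; congr Num.sqrt; lra.
have a0 := acos_ge0 ha; have api := acos_lepi ha; have pi0 := pi_ge0 R.
have [b0|b0] := leP 0 b.
  exists (acos a); first by apply/andP; split => //; lra.
  by rewrite /expi acosK // hs ger0_norm.
exists (2 * pi - acos a); first by apply/andP; split; lra.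
have e2 : 2 * pi = pi *+ 2 :> R by rewrite mulr_natl.
rewrite /expi cosB sinB e2 cos2pi sin2pi acosK // hs ltr0_norm //.
by rewrite mul1r !mul0r addr0 sub0r mul1r opprK.
Qed.

(** Since x may be an endpoint, the interval is taken to one side: to the right if x <= pi, to the
    left otherwise. *)
Lemma itv_in_ball (x e : R) : 0 < e -> 0 <= x <= 2 * pi ->
  exists a b : R, [/\ a < b, `[a, b] `<=` `[0, 2 * pi] &
    forall y, a <= y <= b -> `|x - y| < e].
Proof.
move=> e0 /andP[x0 x2]; have pi0 := pi_gt0 R.
pose m := Num.min e pi / 2.
have me : Num.min e pi <= e by rewrite ge_min lexx.
have mp : Num.min e pi <= pi by rewrite ge_min lexx orbT.
have m0 : 0 < Num.min e pi by rewrite lt_min e0.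
have [xp|px] := leP x pi.
  exists x, (x + m); split; rewrite /m; first by lra.
    by move=> y /=; rewrite ?in_itv /= => /andP[h1 h2]; apply/andP; split; lra.
  by move=> y /andP[h1 h2]; rewrite ltr_norml; apply/andP; split; lra.
exists (x - m), x; split; rewrite /m; first by lra.
  by move=> y /=; rewrite ?in_itv /= => /andP[h1 h2]; apply/andP; split; lra.
by move=> y /andP[h1 h2]; rewrite ltr_norml; apply/andP; split; lra.
Qed.

(** A value above the essential supremum would persist on a nondegenerate rectangle inside the
    torus, of positive measure. *)
Lemma continuous_le_ess_sup (h : R * R -> R) (x y : R) : continuous h ->
  0 <= x <= 2 * pi -> 0 <= y <= 2 * pi ->
  ((h (x, y))%:E <= ess_sup (@torus_measure R) (fun z => (h z)%:E))%E.
Proof.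
move=> ch hx hy; set s := ess_sup _ _; rewrite leNgt; apply/negP => lt_s.
have [c [sc cx]] : exists c : R, (s <= c%:E)%E /\ c < h (x, y).
  case: s lt_s => [r||] //; first by exists r.
  by exists (h (x, y) - 1); split; rewrite ?leNye //; lra.
have : \forall z \near (x, y), c < h z by exact: (cvgr_gt (h (x, y)) (ch (x, y))).
move=> [[U V] /= [/nbhs_ballP[e1 /= e10 hU] /nbhs_ballP[e2 /= e20 hV]] hUV].
have [a1 [b1 [ab1 sub1 near1]]] := itv_in_ball e10 hx.
have [a2 [b2 [ab2 sub2 near2]]] := itv_in_ball e20 hy.
have : \forall z \ae (@torus_measure R), ((h z)%:E <= s)%E by exact: ess_sup_ge.
move=> [N [mN N0 hN]].
have sub : `[a1, b1] `*` `[a2, b2] `<=` N `&` @torus R.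
  move=> z [z1 z2]; split; last by split; [exact: sub1|exact: sub2].
  apply: hN => /= hz.
  have : c < h z.
    apply: (hUV z); split; [apply: hU|apply: hV]; rewrite /ball /=; [apply: near1|apply: near2].
      by move: z1; rewrite /= in_itv.
    by move: z2; rewrite /= in_itv.
  by rewrite ltNge -lee_fin (le_trans hz sc).
have mtor : measurable (`[a1, b1] `*` `[a2, b2]) by apply: measurableX; exact: measurable_itv.
have : (((lebesgue_measure \x lebesgue_measure) (`[a1, b1] `*` `[a2, b2]) : \bar R) <= 0)%E.
  rewrite -N0; apply: le_measure; rewrite ?inE //.
  by apply: measurableI => //; exact: (@measurable_torus R).
rewrite product_measure1E; [|exact: measurable_itv|exact: measurable_itv].
have len (a b : R) : a < b -> lebesgue_measure `[a, b] = (b - a)%:E.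
  by move=> ab; rewrite lebesgue_measure_itv /= lte_fin ab EFinD.
move=> le0; have : ((b1 - a1)%:E * (b2 - a2)%:E <= 0)%E.
  by rewrite -(len _ _ ab1) -(len _ _ ab2); exact: le0.
by rewrite -EFinM lee_fin leNgt mulr_gt0 ?subr_gt0.
Qed.

Lemma continuous_sum_fun (I : Type) (r : seq I) (F : I -> R * R -> R) :
  (forall i, continuous (F i)) -> continuous (fun z => \sum_(i <- r) F i z).
Proof.
move=> hF; elim: r => [|i r IHr].
  have -> : (fun z => \sum_(i <- [::]) F i z) = cst 0 by apply/funext => z; rewrite big_nil.
  exact: cst_continuous.
have -> : (fun z => \sum_(j <- i :: r) F j z) = (F i \+ (fun z => \sum_(j <- r) F j z)).
  by apply/funext => z; rewrite big_cons.
by move=> z; apply: continuousD; [exact: hF|exact: IHr].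
Qed.

Lemma continuous_monomial (c : C) (j k : int) :
  continuous (fun z => complex.Re (c * character j k z)) /\
  continuous (fun z => complex.Im (c * character j k z)).
Proof.
pose th (z : R * R) := j%:~R * z.1 + k%:~R * z.2.
have cth : continuous th.
  have -> : th = (cst j%:~R \* fst) \+ (cst k%:~R \* snd) by [].
  move=> z; apply: continuousD; apply: continuousM; try exact: cst_continuous.
    exact: cvg_fst.
  exact: cvg_snd.
have ccos : continuous (cos \o th).
  by move=> z; apply: continuous_comp; [exact: cth|exact: continuous_cos].
have csin : continuous (sin \o th).
  by move=> z; apply: continuous_comp; [exact: cth|exact: continuous_sin].
case: c => a b; split.
  have -> : (fun z => complex.Re ((a +i* b) * character j k z)) =
      (cst a \* (cos \o th)) \- (cst b \* (sin \o th)) by [].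
  by move=> z; apply: continuousB; apply: continuousM;
    first [exact: cst_continuous|exact: ccos|exact: csin].
have -> : (fun z => complex.Im ((a +i* b) * character j k z)) =
    (cst a \* (sin \o th)) \+ (cst b \* (cos \o th)) by [].
by move=> z; apply: continuousD; apply: continuousM;
    first [exact: cst_continuous|exact: ccos|exact: csin].
Qed.

Lemma continuous_rnorm_trig (I J : Type) (r : seq I) (s : seq J) (c : I -> J -> C)
    (u : I -> int) (v : J -> int) :
  continuous (fun z => rnorm (\sum_(i <- r) \sum_(j <- s) c i j * character (u i) (v j) z)).
Proof.
pose g (z : R * R) := \sum_(i <- r) \sum_(j <- s) c i j * character (u i) (v j) z.
have cRe : continuous (fun z => complex.Re (g z)).
  have -> : (fun z => complex.Re (g z)) = (fun z => \sum_(i <- r) \sum_(j <- s)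
      complex.Re (c i j * character (u i) (v j) z)).
    by apply/funext => z; rewrite raddf_sum; apply: eq_bigr => i _; rewrite raddf_sum.
  apply: continuous_sum_fun => i; apply: continuous_sum_fun => j.
  by have [] := continuous_monomial (c i j) (u i) (v j).
have cIm : continuous (fun z => complex.Im (g z)).
  have -> : (fun z => complex.Im (g z)) = (fun z => \sum_(i <- r) \sum_(j <- s)
      complex.Im (c i j * character (u i) (v j) z)).
    by apply/funext => z; rewrite raddf_sum; apply: eq_bigr => i _; rewrite raddf_sum.
  apply: continuous_sum_fun => i; apply: continuous_sum_fun => j.
  by have [] := continuous_monomial (c i j) (u i) (v j).
have -> : (fun z => rnorm (g z)) =
    Num.sqrt \o (((fun z => complex.Re (g z)) \* (fun z => complex.Re (g z))) \+
      ((fun z => complex.Im (g z)) \* (fun z => complex.Im (g z)))).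
  apply/funext => z; apply: complexI; rewrite rnormE normc_def.
  by rewrite /= -!expr2.
move=> z; apply: continuous_comp; last exact: sqrt_continuous.
by apply: continuousD; apply: continuousM; [exact: cRe|exact: cRe|exact: cIm|exact: cIm].
Qed.

Lemma sum_centered (V : nmodType) (F : int -> V) (N : nat) :
  (forall j : int, j < 0 -> F j = 0) ->
  \sum_(i < (N + N).+1) F (i%:Z - N%:Z) = \sum_(j < N.+1) F j%:Z.
Proof.
move=> F0; rewrite -(big_mkord predT (fun i => F (i%:Z - N%:Z))).
rewrite (@big_cat_nat _ _ _ N) //= ?leqW ?leq_addr // big1_seq ?add0r; last first.
  by move=> i /=; rewrite mem_index_iota => /andP[_ h]; apply: F0; rewrite subr_lt0 ltz_nat.
rewrite -{1}[N]add0n big_addn subSn ?leq_addr // addKn big_mkord.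
by apply: eq_bigr => j _; rewrite PoszD addrK.
Qed.

(** Analyticity removes the negative frequencies, so the centred sum [LPfun] collapses to a
    polynomial. Continuity turns the almost everywhere bound into one at every point, as
    [torus_bound] demands. *)
Lemma poly_eval_le_Linfty (w : R -> R) (f : torus_distribution R) n (z1 z2 : C) :
  (forall j k, Num.min j k < 0 -> fourier f j k = 0) ->
  rnorm z1 = 1 -> rnorm z2 = 1 ->
  ((rnorm (poly_eval (2 ^ n.+1) (fun j k => LPcoef w f n j%:Z k%:Z) z1 z2))%:E <=
    Linfty_norm (LPfun w f n))%E.
Proof.
move=> f0 /unit_expi[x hx ->] /unit_expi[y hy ->].
have -> : poly_eval (2 ^ n.+1) (fun j k => LPcoef w f n j%:Z k%:Z) (expi x) (expi y) =
    LPfun w f n (x, y).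
  rewrite /LPfun (_ : (2 ^ n.+2) = (2 ^ n.+1 + 2 ^ n.+1))%N; last first.
    by rewrite expnS mul2n addnn.
  set N := (2 ^ n.+1)%N.
  have c0 j k : Num.min j k < 0 -> LPcoef w f n j k = 0.
    by move=> h; rewrite /LPcoef f0 // mul0r.
  rewrite (sum_centered (F := fun j => \sum_(l < (N + N).+1)
      LPcoef w f n j (l%:Z - N%:Z) * character j (l%:Z - N%:Z) (x, y))); last first.
    move=> j j0; rewrite big1 // => l _; rewrite c0 ?mul0r //.
    by rewrite gt_min j0.
  apply: eq_bigr => j _.
  rewrite (sum_centered (F := fun l => LPcoef w f n j%:Z l * character j%:Z l (x, y))); last first.
    by move=> l l0; rewrite c0 ?mul0r // gt_min l0 orbT.
  apply: eq_bigr => k _; congr (_ * _).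
  by rewrite /character /= expiD -!pmulrn !expi_nat.
rewrite /Linfty_norm; apply: (continuous_le_ess_sup (h := fun z => rnorm (LPfun w f n z))) => //.
exact: continuous_rnorm_trig.
Qed.

End SupNorm.

(** * Convergence of the calculus *)

Section OperatorSeries.
Variables (R : realType) (H : separable_hilbert R).
Variables (u : nat -> H -> H) (m : nat -> R) (S : R).
Hypotheses (lin_u : forall n, linear (u n)) (m0 : forall n, 0 <= m n).
Hypothesis u_le : forall n x, rnorm (u n x) <= m n * rnorm x.
Hypothesis m_le : forall N, \sum_(n < N) m n <= S.

(** Limits are taken vector by vector, using completeness. The tail bound s - T N, with s the
    supremum of the partial sums of m, is uniform on the unit ball, and it yields linearity of the
    limit and convergence in operator norm. *)
Lemma operator_series_limit : exists A : H -> H, bounded_operator A /\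
  opnorm (fun x => A x - \sum_(n < N) u n x) @[N --> \oo] --> (0 : \bar R).
Proof.
pose T N := \sum_(n < N) m n.
have T_nd : nondecreasing_seq T by apply/nondecreasing_seqP => n; rewrite /T big_ord_recr lerDl.
have T_ub : has_ubound (range T) by exists S => _ [n _ <-]; exact: m_le.
have T_cvg := nondecreasing_cvgn T_nd T_ub; set s := sup (range T) in T_cvg.
have T_le N : T N <= s by apply: ub_le_sup => //; exists N.
have T0 N : 0 <= T N by apply: sumr_ge0.
have tail_small (eps : R) : 0 < eps -> exists N0, forall N, (N0 <= N)%N -> s - T N < eps.
  move=> eps0; have /cvgrPdist_lt/(_ _ eps0)[N0 _ hN0] := T_cvg.
  by exists N0 => N hN; have := hN0 N hN; rewrite ger0_norm ?subr_ge0.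
pose v N x := \sum_(n < N) u n x.
have v_diff x N M : (N <= M)%N -> rnorm (\sum_(N <= k < M) u k x) <= (s - T N) * rnorm x.
  move=> NM; apply: le_trans (rnorm_sum _ _ _) _.
  apply: (@le_trans _ _ (\sum_(N <= k < M) m k * rnorm x)).
    by apply: ler_sum => k _; exact: u_le.
  rewrite -mulr_suml ler_wpM2r ?rnorm_ge0 // lerBrDl.
  have <- : T M = T N + \sum_(N <= k < M) m k.
    by rewrite /T -!(big_mkord predT m) -big_cat_nat.
  exact: T_le.
have v_split x N M : (N <= M)%N -> v M x = v N x + \sum_(N <= k < M) u k x.
  move=> NM; rewrite /v -(big_mkord predT (fun k => u k x)).
  by rewrite -(big_mkord predT (fun k => u k x)) -big_cat_nat.
have lim_ex x : exists l : H, forall eps : R, 0 < eps ->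
    exists N0, forall N, (N0 <= N)%N -> rnorm (l - v N x) < eps.
  have : cvgn (series (fun n => u n x)).
    apply/cauchy_cvgP/cauchy_seriesP => e e0.
    have eE : e = (complex.Re e)%:C by rewrite RRe_real // gtr0_real.
    have Re0 : 0 < complex.Re e by rewrite -ltcR -eE.
    have x0 := rnorm_ge0 x.
    have q0 : 0 < complex.Re e / (rnorm x + 1) by rewrite divr_gt0 // ltr_wpDl.
    have [N0 hN0] := tail_small _ q0.
    exists ([set n | (N0 <= n)%N], [set n | (N0 <= n)%N]).
      by split; exists N0.
    move=> [a b] [/= ha hb]; rewrite -rnormE [ltRHS]eE ltcR.
    have [ab|ba] := leqP a b; last by rewrite big_geq ?rnorm0 // ltnW.
    apply: le_lt_trans (v_diff x a b ab) _.
    apply: (@le_lt_trans _ _ ((complex.Re e / (rnorm x + 1)) * rnorm x)).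
      by rewrite ler_wpM2r // ltW // hN0.
    rewrite mulrAC ltr_pdivrMr ?ltr_wpDl // ltr_pM2l //; lra.
  move=> /cvg_ex[l hl]; exists l => eps eps0.
  have epsC : 0 < eps%:C :> R[i] by rewrite ltcR.
  have /cvgrPdist_lt/(_ _ epsC)[N0 _ hN0] := hl.
  exists N0 => N hN; rewrite -ltcR rnormE; have := hN0 N hN.
  by rewrite /series /= big_mkord.
pose A x := sval (cid (lim_ex x)).
have hA x : forall eps : R, 0 < eps ->
    exists N0, forall N, (N0 <= N)%N -> rnorm (A x - v N x) < eps.
  exact: (svalP (cid (lim_ex x))).
have A_tail x N : rnorm (A x - v N x) <= (s - T N) * rnorm x.
  apply/ler_addgt0Pr => eps eps0; have [N0 hN0] := hA x eps eps0.
  pose M := maxn N0 N.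
  have -> : A x - v N x = (A x - v M x) + \sum_(N <= k < M) u k x.
    by rewrite (v_split x N M) ?leq_maxr // opprD addrA addrNK.
  apply: le_trans (rnormD _ _) _; rewrite addrC; apply: lerD.
    by apply: v_diff; exact: leq_maxr.
  by rewrite ltW // hN0 // leq_maxl.
have lin_v N : linear (v N).
  by move=> a x y; rewrite /v scaler_sumr -big_split; apply: eq_bigr => k _; rewrite lin_u.
have lin_A : linear A.
  move=> a x y; apply/eqP; rewrite -subr_eq0 -rnorm_eq0 eq_le rnorm_ge0 andbT.
  pose c := rnorm (a *: x + y) + rnorm a * rnorm x + rnorm y.
  have c0 : 0 <= c by rewrite !addr_ge0 ?mulr_ge0 ?rnorm_ge0.
  apply/ler_addgt0Pr => eps eps0; rewrite add0r.
  have q0 : 0 < eps / (c + 1) by rewrite divr_gt0 // ltr_wpDl.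
  have [N hN] := tail_small _ q0; have hN1 := hN N (leqnn _).
  have -> : A (a *: x + y) - (a *: A x + A y) =
      (A (a *: x + y) - v N (a *: x + y)) - a *: (A x - v N x) - (A y - v N y).
    rewrite lin_v scalerBr !opprB -addrA [_ - a *: A x + _]addrACA.
    by rewrite subrKA opprD.
  have h1 := A_tail (a *: x + y) N; have h2 := A_tail x N; have h3 := A_tail y N.
  apply: le_trans (rnormB _ _) _; apply: le_trans (lerD (rnormB _ _) (lexx _)) _.
  rewrite rnormZ; have := ler_wpM2l (rnorm_ge0 a) h2.
  have : (s - T N) * c <= eps.
    apply: le_trans (ler_wpM2r c0 (ltW hN1)) _.
    rewrite mulrAC ler_pdivrMr ?ltr_wpDl // ler_pM2l //; lra.
  by rewrite /c; lra.
exists A; split.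
  apply/bounded_operatorP; split=> //; exists s; first by apply: le_trans (T0 0%N) (T_le _).
  by move=> x; have := A_tail x 0%N; rewrite /v /T !big_ord0 !subr0.
apply: (@squeeze_cvge _ _ _ _ (fun _ => 0%E) _ (fun N => (s - T N)%:E)).
- apply: nearW => N; rewrite opnorm_ge0 /=; apply: opnorm_le; first by rewrite subr_ge0.
  by move=> x; exact: A_tail.
- exact: cvg_cst.
apply/fine_cvgP; split; first exact: nearW.
apply/cvgrPdist_lt => eps eps0; have [N0 hN0] := tail_small eps eps0.
exists N0 => // N hN /=; rewrite sub0r normrN ger0_norm ?subr_ge0 //; exact: hN0.
Qed.

End OperatorSeries.

Section BesovCalculus.
Variables (R : realType) (w : R -> R) (f : torus_distribution R).
Hypothesis hf : besov_plus w f.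
Local Notation C := R[i].

Definition block_coef (n j k : nat) : C := LPcoef w f n j%:Z k%:Z.
Definition block_sup n : R := fine (Linfty_norm (LPfun w f n)).

Let le_Linfty n (z1 z2 : C) : rnorm z1 = 1 -> rnorm z2 = 1 ->
  ((rnorm (poly_eval (2 ^ n.+1) (block_coef n) z1 z2))%:E <= Linfty_norm (LPfun w f n))%E.
Proof. by move=> h1 h2; apply: poly_eval_le_Linfty => //; exact: hf.2. Qed.

Let Linfty_ge0 n : (0 <= Linfty_norm (LPfun w f n))%E.
Proof.
apply: le_trans (le_Linfty n (rnorm1 R) (rnorm1 R)).
by rewrite lee_fin rnorm_ge0.
Qed.

Let term_ge0 n : (0 <= (2 ^+ n)%:E * Linfty_norm (LPfun w f n))%E.
Proof. by rewrite mule_ge0 // lee_fin exprn_ge0. Qed.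

Lemma besov_norm_ge0 : (0 <= besov_norm w f)%E.
Proof. by apply: nneseries_ge0 => n _ _; exact: term_ge0. Qed.

Lemma besov_norm_fin : besov_norm w f \is a fin_num.
Proof. by rewrite ge0_fin_numE ?besov_norm_ge0 //; exact: hf.1. Qed.

Let partial_le m :
  (\sum_(0 <= n < m) (2 ^+ n)%:E * Linfty_norm (LPfun w f n) <= besov_norm w f)%E.
Proof. by apply: nneseries_lim_ge => n _ _; exact: term_ge0. Qed.

Lemma Linfty_fin n : Linfty_norm (LPfun w f n) \is a fin_num.
Proof.
rewrite ge0_fin_numE //; have := partial_le n.+1.
rewrite big_nat_recr //=; move=> h.
have : ((2 ^+ n)%:E * Linfty_norm (LPfun w f n) < +oo)%E.
  apply: le_lt_trans hf.1; apply: le_trans h.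
  by apply: leeDr; apply: sume_ge0 => k _; exact: term_ge0.
have p0 : (0 < (2 ^+ n)%:E :> \bar R)%E by rewrite lte_fin exprn_gt0.
move: (Linfty_ge0 n); case: (Linfty_norm _) => [c||] // _.
  by move=> _; exact: ltry.
by rewrite gt0_muley.
Qed.

Lemma block_torus_bound n : torus_bound (2 ^ n.+1) (block_coef n) (block_sup n).
Proof.
by move=> z1 z2 h1 h2; rewrite -lee_fin fineK ?Linfty_fin //; exact: le_Linfty.
Qed.

(** Block k has degree 2^(k+1), twice the Besov weight 2^k, and the constant of the calculus is 3:
    hence 6. *)
Lemma block_sum_le m :
  \sum_(k < m) 3 * (2 ^ k.+1)%:R * block_sup k <= 6 * fine (besov_norm w f).
Proof.
have -> : \sum_(k < m) 3 * (2 ^ k.+1)%:R * block_sup k =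
    6 * \sum_(k < m) 2 ^+ k * block_sup k.
  by rewrite mulr_sumr; apply: eq_bigr => k _; rewrite natrX exprS; ring.
rewrite ler_pM2l // -lee_fin fineK ?besov_norm_fin //.
apply: le_trans (partial_le m); rewrite big_mkord -sumEFin le_eqVlt.
apply/orP; left; apply/eqP; apply: eq_bigr => k _.
by rewrite EFinM fineK ?Linfty_fin.
Qed.

Variable H : separable_hilbert R.
Implicit Types (T S : H -> H).

Lemma linear_op_calc N (g : nat -> nat -> C) T S : linear T -> linear S ->
  linear (op_calc N g T S).
Proof.
move=> linT linS a x y; rewrite /op_calc scaler_sumr -big_split.
apply: eq_bigr => j _ /=.
rewrite -(linear_opZ (linear_iter linT j)) -(linear_opD (linear_iter linT j)).
congr (iter j T _); rewrite scaler_sumr -big_split; apply: eq_bigr => k _ /=.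
by rewrite (linear_iter linS k) scalerDr !scalerA mulrC.
Qed.

(** [fun_calc] is picked by [get], so it means something only once a limit is shown to exist. *)
Lemma fun_calc_limit T S : contraction_operator T -> contraction_operator S ->
  bounded_operator (fun_calc w f T S) /\
  (opnorm (fun x : H => fun_calc w f T S x - \sum_(n < N) fun_calc_block w f T S n x)
     @[N --> \oo] --> (0 : \bar R)).
Proof.
move=> cT cS; have [linT _] := contraction_rnorm cT; have [linS _] := contraction_rnorm cS.
suff /getPex h : exists A : H -> H, bounded_operator A /\
    (opnorm (fun x => A x - \sum_(n < N) fun_calc_block w f T S n x)
       @[N --> \oo] --> (0 : \bar R)) by exact: h.
apply: (@operator_series_limit _ _ _ (fun n => 3 * (2 ^ n.+1)%:R * block_sup n)
  (6 * fine (besov_norm w f))).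
- by move=> n; exact: (linear_op_calc (2 ^ n.+1) (block_coef n) linT linS).
- by move=> n; rewrite !mulr_ge0 //; exact: torus_bound_ge0 (@block_torus_bound n).
- move=> n x; apply: (op_calc_rnorm x _ (@block_torus_bound n) cT cS).
  by rewrite expn_gt0.
- exact: block_sum_le.
Qed.

End BesovCalculus.

(** * Partial sums of singular values and the Schatten norm *)

Section SchattenNorm.
Variables (R : realType) (H : separable_hilbert R) (p : R).
Hypothesis p1 : 1 <= p.

Let p_gt0 : 0 < p. Proof. exact: lt_le_trans p1. Qed.

Lemma schatten_partial_sum_le (A : H -> H) n : schatten_class p A ->
  \sum_(k < n) fine (singular_value k A) `^ p <= fine (schatten_norm p A) `^ p.
Proof.
move=> [bA]; rewrite /schatten_norm; set Z := (\sum_(0 <= k <oo) _)%E => hZ.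
have Z0 : (0 <= Z)%E by apply: nneseries_ge0 => k _ _; exact: poweR_ge0.
have hpart : (\sum_(0 <= k < n) singular_value k A `^ p <= Z)%E.
  by apply: nneseries_lim_ge => k _ _; exact: poweR_ge0.
case: Z Z0 hpart hZ => [z||] //=; last by rewrite invr_eq0 gt_eqF.
move=> z0 hpart _; rewrite -powRrM mulVf ?gt_eqF // powRr1 //.
rewrite -lee_fin -sumEFin; apply: le_trans hpart; rewrite big_mkord.
apply: lee_sum => k _; by rewrite -poweR_EFin fineK ?singular_value_fin.
Qed.

(** The greedy choice controls only singular values of even index; each odd one is at most its
    predecessor, which doubles c. *)
Lemma schatten_norm_le (A : H -> H) (c : R) : bounded_operator A -> 0 <= c ->
  (forall n, \sum_(k < n) fine (singular_value (k + k) A) `^ p <= c) ->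
  (schatten_norm p A <= ((2 * c) `^ p^-1)%:E)%E.
Proof.
move=> bA c0 hc.
pose a k := fine (singular_value k A) `^ p.
have a0 k : 0 <= a k by exact: powR_ge0.
have aE k : (singular_value k A `^ p = (a k)%:E)%E.
  by rewrite /a -poweR_EFin fineK ?singular_value_fin.
have a_noninc k : a k.+1 <= a k.
  apply: ge0_ler_powR; rewrite ?nnegrE ?fine_ge0 ?singular_value_ge0 ?(ltW p_gt0) //.
  by rewrite fine_le ?singular_value_fin ?singular_value_nonincreasing.
have even_sum n : \sum_(k < n + n) a k <= 2 * \sum_(k < n) a (k + k)%N.
  elim: n => [|n IHn]; first by rewrite !big_ord0 mulr0.
  rewrite addSn addnS !big_ord_recr /= mulrDr -addrA lerD //.
  by rewrite mulr_natl mulr2n lerD2l a_noninc.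
have Zle : (\sum_(0 <= k <oo) singular_value k A `^ p <= (2 * c)%:E)%E.
  apply: lime_le; first by apply: is_cvg_nneseries => k _ _; exact: poweR_ge0.
  apply: nearW => n.
  rewrite big_mkord; under eq_bigr => k _ do rewrite aE.
  rewrite sumEFin lee_fin.
  apply: le_trans (ler_sum_ord_widen (f := a) (leq_addr n n) a0) _.
  by apply: le_trans (even_sum n) _; rewrite ler_pM2l.
apply: (@le_trans _ _ ((2 * c)%:E `^ p^-1)%E); last by [].
apply: gt0_ler_poweR => //; first by rewrite invr_ge0 ltW.
  by rewrite in_itv /= leey andbT; apply: nneseries_ge0 => k _ _; exact: poweR_ge0.
by rewrite in_itv /= leey andbT lee_fin mulr_ge0.
Qed.

End SchattenNorm.

Lemma rnorm_ip_le (R : realType) (H : separable_hilbert R) (e : nat -> H) n x i :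
  orthonormal0 e n -> (i < n)%N -> rnorm (@inner R H x (e i)) <= rnorm x.
Proof.
move=> he hi; rewrite -(@ler_pXn2r _ 2) ?nnegrE ?rnorm_ge0 //.
apply: le_trans (fro2_coo_le he x); rewrite fro2_cV (bigD1 (Ordinal hi)) //= mxE.
by rewrite lerDl sumr_ge0 // => j _; exact: sqr_ge0.
Qed.

Lemma orthonormal0_rnorm_le1 (R : realType) (H : separable_hilbert R) (e : nat -> H) n i :
  orthonormal0 e n -> (i < n)%N -> rnorm (e i) <= 1.
Proof.
move=> he hi; rewrite -(@ler_pXn2r _ 2) ?nnegrE ?rnorm_ge0 // expr1n -lecR -ip_rnorm.
rewrite he // eqxx /=; case: (e i != 0); rewrite ?rmorph1 ?lexx //.
Qed.

(** * Assembling the estimate *)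

Section MainEstimate.
Variables (R : realType) (w : R -> R) (f : torus_distribution R) (H : separable_hilbert R).
Variables (p : R) (T1 S1 T0 S0 : H -> H).
Hypotheses (hp : 1 <= p <= 2) (hf : besov_plus w f).
Hypotheses (cT1 : contraction_operator T1) (cS1 : contraction_operator S1).
Hypotheses (cT0 : contraction_operator T0) (cS0 : contraction_operator S0).
Hypotheses (hT : schatten_class p (T1 \- T0)) (hS : schatten_class p (S1 \- S0)).

Let D := fun_calc w f T1 S1 \- fun_calc w f T0 S0.
Let K := 6 * fine (besov_norm w f).
Let X := fine (schatten_norm p (T1 \- T0)) `^ p + fine (schatten_norm p (S1 \- S0)) `^ p.

Lemma fun_calc_diff_bounded : bounded_operator D.
Proof.
apply: bounded_operator_sub; first by have [] := fun_calc_limit hf cT1 cS1.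
by have [] := fun_calc_limit hf cT0 cS0.
Qed.

(** For fixed n the calculus may be truncated after finitely many blocks at the cost of an arbitrary
    eps. The truncation satisfies [op_calc_difference_bound] with constants independent of its
    length; 64 = 4 * 16, the 4 paying for the truncation. *)
Lemma fun_calc_diff_coefficients n (e e' : nat -> H) :
  orthonormal0 e n -> orthonormal0 e' n ->
  \sum_(i < n) rnorm (@inner R H (D (e i)) (e' i)) `^ p <= 64 * (K `^ p * X).
Proof.
move=> he he'; have [p1 p2] := andP hp; have p0 : 0 <= p by lra.
apply/ler_addgt0Pr => eps eps0.
(* As eta <= 1 <= p one has eta^p <= eta, so the n error terms add up to at most 4 n eta <= eps. *)
pose eta := Num.min 1 (eps / (4 * (n%:R + 1))).
have n0 : 0 <= n%:R :> R by exact: ler0n.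
have eta0 : 0 < eta by rewrite lt_min ltr01 divr_gt0 //; lra.
have eta1 : eta <= 1 by rewrite ge_min lexx.
have etaE : 4 * (n%:R * eta) <= eps.
  have h : eta <= eps / (4 * (n%:R + 1)) by rewrite ge_min lexx orbT.
  have q : 0 < 4 * (n%:R + 1) :> R by lra.
  rewrite ler_pdivlMr // in h; have := ltW eta0; nra.
have delta0 : 0 < eta / 2 by lra.
have [_ L1] := fun_calc_limit hf cT1 cS1; have [_ L0] := fun_calc_limit hf cT0 cS0.
pose err T S N := opnorm (fun x : H => fun_calc w f T S x -
  \sum_(n < N) fun_calc_block w f T S n x).
have close T S : (err T S N @[N --> \oo] --> (0 : \bar R)) ->
    \forall N \near \oo, (err T S N < (eta / 2)%:E)%E.
  move=> L; apply: (L [set y | (y < (eta / 2)%:E)%E]).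
  exact: (nbhs_open_ereal_lt (f := fun=> eta / 2) delta0).
have [N [h1 h0]] : exists N,
    (err T1 S1 N < (eta / 2)%:E)%E /\ (err T0 S0 N < (eta / 2)%:E)%E.
  have [N1 _ hN1] := close _ _ L1; have [N0 _ hN0] := close _ _ L0.
  by exists (maxn N1 N0); split; [apply: hN1; exact: leq_maxl|apply: hN0; exact: leq_maxr].
pose DN x := \sum_(k < N) (fun_calc_block w f T1 S1 k x - fun_calc_block w f T0 S0 k x).
have near_D (i : 'I_n) : rnorm (@inner R H (D (e i)) (e' i)) <=
    rnorm (@inner R H (DN (e i)) (e' i)) + eta.
  have -> : D (e i) = DN (e i) + (D (e i) - DN (e i)) by rewrite addrC subrK.
  rewrite ipDl; apply: le_trans (rnormD _ _) _; rewrite lerD2l.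
  apply: le_trans (rnorm_ip_le _ he' (ltn_ord i)) _.
  have e1 := orthonormal0_rnorm_le1 he (ltn_ord i).
  have k1 := le_lt_trans (opnorm_ub _ e1) h1; have k0 := le_lt_trans (opnorm_ub _ e1) h0.
  rewrite !lte_fin in k1 k0.
  have -> : D (e i) - DN (e i) =
     (fun_calc w f T1 S1 (e i) - \sum_(n < N) fun_calc_block w f T1 S1 n (e i)) -
     (fun_calc w f T0 S0 (e i) - \sum_(n < N) fun_calc_block w f T0 S0 n (e i)).
    by rewrite /D /DN /= sumrB !opprB addrACA [RHS]addrACA [X in _ + X = _]addrC.
  by apply: le_trans (rnormB _ _) _; lra.
apply: (@le_trans _ _ (\sum_(i < n) 4 * (rnorm (@inner R H (DN (e i)) (e' i)) `^ p + eta))).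
  apply: ler_sum => i _.
  apply: (@le_trans _ _ ((rnorm (@inner R H (DN (e i)) (e' i)) + eta) `^ p)).
    apply: ge0_ler_powR; rewrite ?nnegrE ?rnorm_ge0 //.
    by rewrite addr_ge0 ?rnorm_ge0 // ltW.
  apply: le_trans (powR_add_le hp (rnorm_ge0 _) (ltW eta0)) _.
  rewrite ler_pM2l // lerD2l; apply: ge1r_powR => //.
  by rewrite eta0 eta1.
rewrite -mulr_sumr big_split /= sumr_const card_ord -[eta *+ n]mulr_natl mulrDr.
apply: lerD; last exact: etaE.
have [d hd] := op_calc_difference_bound N hp (fun k => @block_torus_bound R w f hf k)
  cT1 cS1 cT0 cS0 he he'.
have hd' : \sum_(i < n) rnorm (@inner R H (DN (e i)) (e' i)) `^ p <=
  16 * ((\sum_(k < N) 3 * (2 ^ k.+1)%:R * block_sup w f k) `^ p *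
    (\sum_(k < d) fine (singular_value k (T1 \- T0)) `^ p +
     \sum_(k < d) fine (singular_value k (S1 \- S0)) `^ p)) := hd.
apply: le_trans (ler_wpM2l (ler0n R 4) hd') _.
rewrite [leLHS]mulrA -natrM ler_pM2l //.
have q0 : 0 <= \sum_(k < N) 3 * (2 ^ k.+1)%:R * block_sup w f k.
  apply: sumr_ge0 => k _; rewrite !mulr_ge0 //.
  exact: torus_bound_ge0 (@block_torus_bound R w f hf k).
apply: ler_pM; rewrite ?powR_ge0 //.
- by apply: addr_ge0; apply: sumr_ge0 => k _; exact: powR_ge0.
- apply: ge0_ler_powR; rewrite ?nnegrE //; last exact: block_sum_le.
  by rewrite /K mulr_ge0 // fine_ge0 // besov_norm_ge0.
by apply: lerD; exact: schatten_partial_sum_le.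
Qed.

(** 512 = 2 * 4 * 64: the doubling for odd indices, 2^p <= 4 for the greedy factor 2, and the
    coefficient bound. *)
Lemma fun_calc_diff_schatten : (schatten_norm p D <= ((512 * (K `^ p * X)) `^ p^-1)%:E)%E.
Proof.
have [p1 p2] := andP hp; have p0 : 0 <= p by lra.
have X0 : 0 <= X by rewrite addr_ge0 ?powR_ge0.
have -> : 512 * (K `^ p * X) = 2 * (256 * (K `^ p * X)) by rewrite [RHS]mulrA -natrM.
apply: schatten_norm_le; [exact: p1|exact: fun_calc_diff_bounded| |].
  by apply: mulr_ge0; [exact: ler0n|exact: mulr_ge0 (powR_ge0 _ _) X0].
move=> n; have [e [e' [he he' hsv]]] := greedy_singular_vectors n fun_calc_diff_bounded.
apply: (@le_trans _ _ (\sum_(i < n) 4 * rnorm (@inner R H (D (e i)) (e' i)) `^ p)).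
  apply: ler_sum => i _.
  have h : fine (singular_value (i + i) D) <= 2 * rnorm (@inner R H (D (e i)) (e' i)).
    rewrite -lee_fin fineK ?hsv //; apply: singular_value_fin; exact: fun_calc_diff_bounded.
  apply: (@le_trans _ _ ((2 * rnorm (@inner R H (D (e i)) (e' i))) `^ p)).
    apply: ge0_ler_powR; rewrite ?nnegrE ?mulr_ge0 ?rnorm_ge0 //.
    by rewrite fine_ge0 ?singular_value_ge0.
  rewrite powRM ?rnorm_ge0 // ler_wpM2r ?powR_ge0 //.
  have -> : 4 = 2 `^ 2 :> R by rewrite -[2 in X in _ `^ X]/(2%:R) powR_mulrn //; ring.
  by apply: ler_powR => //; lra.
rewrite -mulr_sumr; apply: le_trans (ler_wpM2l _ (fun_calc_diff_coefficients he he')) _ => //.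
by rewrite [leLHS]mulrA -natrM.
Qed.

End MainEstimate.

(** t^p + r^p is at most twice the p-th power of the maximum, and the p-th root of 2 c is at most 2
    c since 2 c >= 1; the resulting constant is free of p. *)
Lemma powR_sum_root_le (R : realType) (p c b t r : R) :
  1 <= p -> 1 <= c -> 0 <= b -> 0 <= t -> 0 <= r ->
  (c * (b `^ p * (t `^ p + r `^ p))) `^ p^-1 <= 2 * c * b * Num.max t r.
Proof.
move=> p1 c1 b0 t0 r0; have p0 : 0 < p by lra.
set m := Num.max t r.
have tm : t <= m by rewrite /m le_max lexx.
have rm : r <= m by rewrite /m le_max lexx orbT.
have m0 : 0 <= m by exact: le_trans t0 tm.
have tmp : t `^ p <= m `^ p by apply: ge0_ler_powR; rewrite ?nnegrE // ltW.
have rmp : r `^ p <= m `^ p by apply: ge0_ler_powR; rewrite ?nnegrE // ltW.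
have c0 : 0 <= c by lra.
have c20 : 0 <= 2 * c by lra.
have cb0 : 0 <= 2 * c * b * m by rewrite !mulr_ge0.
have -> : 2 * c * b * m = ((2 * c * b * m) `^ p) `^ p^-1.
  by rewrite -powRrM mulfV ?gt_eqF // powRr1.
apply: ge0_ler_powR; [by rewrite invr_ge0 ltW| |exact: powR_ge0|].
  by rewrite nnegrE; apply: mulr_ge0 => //; rewrite mulr_ge0 ?addr_ge0 ?powR_ge0.
rewrite powRM ?(mulr_ge0 c20) // powRM //.
have h1 : 2 * c <= (2 * c) `^ p by apply: le1r_powR => //; lra.
have h2 : b `^ p * (t `^ p + r `^ p) <= 2 * (b `^ p * m `^ p).
  by rewrite mulrCA ler_wpM2l ?powR_ge0 //; lra.
apply: le_trans (ler_wpM2l c0 h2) _.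
rewrite [leLHS]mulrA [c * 2]mulrC -[leRHS]mulrA ler_wpM2r //.
by apply: mulr_ge0; exact: powR_ge0.
Qed.

Theorem theorem4p9 (R : realType) (w : R -> R) (hw : dyadic_window w) :
  exists2 C : R, 0 < C &
  forall (p : R) (f : torus_distribution R) (H : separable_hilbert R)
         (T1 R1 T0 R0 : H -> H),
    1 <= p <= 2 ->
    besov_plus w f ->
    contraction_operator T1 -> contraction_operator R1 ->
    contraction_operator T0 -> contraction_operator R0 ->
    schatten_class p (T1 \- T0) ->
    schatten_class p (R1 \- R0) ->
    let D := fun_calc w f T1 R1 \- fun_calc w f T0 R0 in
    schatten_class p D /\
    (schatten_norm p D <=
      C%:E * besov_norm w f *
      maxe (schatten_norm p (T1 \- T0)%R) (schatten_norm p (R1 \- R0)%R))%E.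
Proof.
have [c c1 cE] : exists2 c : R, 1 <= c & c = 512 by exists 512; rewrite // ler1n.
(* The 512 of [fun_calc_diff_schatten], the 6 of [block_sum_le] and the 2 of [powR_sum_root_le]: a
   numeral, depending neither on w nor on p. *)
exists (2 * c * 6); first by lra.
move=> p f H T1 R1 T0 R0 hp hf cT1 cR1 cT0 cR0 hT hR D.
have [p1 p2] := andP hp.
have main := fun_calc_diff_schatten hp hf cT1 cR1 cT0 cR0 hT hR.
split.
  split; first exact: fun_calc_diff_bounded.
  exact: le_lt_trans main (ltry _).
rewrite -cE in main; apply: le_trans main _.
have sfin (A : H -> H) : schatten_class p A -> schatten_norm p A \is a fin_num.
  by move=> [_ h]; rewrite ge0_fin_numE // poweR_ge0.
rewrite -(fineK (sfin _ hT)) -(fineK (sfin _ hR)) -(fineK (besov_norm_fin hf)).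
rewrite -EFin_max -!EFinM lee_fin -[2 * c * 6 * _]mulrA.
apply: powR_sum_root_le; [exact: p1|exact: c1| | |].
- by apply: mulr_ge0 => //; exact: (fine_ge0 (besov_norm_ge0 hf)).
- exact: (fine_ge0 (poweR_ge0 _ _)).
- exact: (fine_ge0 (poweR_ge0 _ _)).
Qed.
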